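(* If $G$ is an intrinsically knotted graph on $8$ vertices and any one vertex of $G$ and the edges coming into it are removed, then the remaining graph is intrinsically linked.
   Context: Graphs are simple. A graph is intrinsically knotted (respectively, intrinsically linked) if every tame embedding of it in $\mathbb{R}^3$ contains a non-trivially knotted cycle (respectively, a pair of disjoint cycles that are non-trivially linked). *)

(* Defs.v *)
From HB Require Import structures.
From mathcomp Require Import all_boot all_order all_algebra.
From mathcomp Require Import all_classical all_reals all_analysis.

Set Implicit Arguments.
Unset Strict Implicit.
Unset Printing Implicit Defensive.

Import Order.TTheory GRing.Theory Num.Theory.
Import numFieldNormedType.Exports.

Local Open Scope classical_set_scope.
Local Open Scope ring_scope.

Record sgraph := SGraph {
  svertex :> finType;
  sedge : rel svertex;
  sedge_sym : symmetric sedge;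
  sedge_irrefl : irreflexive sedge }.

Section DeleteVertex.
Variables (G : sgraph) (v : G).

Definition del_edge : rel {x : G | x != v} :=
  fun x y => sedge (val x) (val y).

Lemma del_edge_sym : symmetric del_edge.
Proof. by move=> x y; exact: sedge_sym. Qed.

Lemma del_edge_irrefl : irreflexive del_edge.
Proof. by move=> x; exact: sedge_irrefl. Qed.

Definition del_vertex : sgraph := SGraph del_edge_sym del_edge_irrefl.

End DeleteVertex.

(* [c] lists the vertices of the cycle without repetition, in cyclic order; the
   size condition excludes [:: u; v], which would use the edge uv twice. *)
Definition graph_cycle (G : sgraph) (c : seq G) : Prop :=
  ucycle (@sedge G) c /\ (2 < size c)%N.

Definition segment (R : realType) (n : nat) (a b : 'rV[R]_n) : set 'rV[R]_n :=
  [set (1 - t) *: a + t *: b | t in `[0, 1]].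

Section Realization.
Variables (R : realType) (G : sgraph).

(* The topological graph |G| is realized in R^V, with the vertices at the
   standard basis vectors and the edges as straight segments between them. *)
Definition vertex_pt (v : G) : 'rV[R]_#|G| := delta_mx 0 (enum_rank v).

(* The case [u = v] accounts for isolated vertices. *)
Definition realization : set 'rV[R]_#|G| :=
  [set x | exists u v : G,
    (u = v \/ sedge u v) /\ segment (vertex_pt u) (vertex_pt v) x].

Definition cycle_realization (c : seq G) : set 'rV[R]_#|G| :=
  [set x | exists2 u : G,
    u \in c & segment (vertex_pt u) (vertex_pt (next c u)) x].

End Realization.

Arguments realization R G : clear implicits.
Arguments cycle_realization R {G} c.

Definition homeomorphism (T : topologicalType) (h : T -> T) : Prop :=
  continuous h /\
  exists g : T -> T, [/\ continuous g, cancel h g & cancel g h].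

Section Knots.
Variable R : realType.
Implicit Types K A B : set 'rV[R]_3.

Definition xcoord (p : 'rV[R]_3) : R := p 0 (inord 0).
Definition ycoord (p : 'rV[R]_3) : R := p 0 (inord 1).
Definition zcoord (p : 'rV[R]_3) : R := p 0 (inord 2).

Definition polygonal A : Prop :=
  exists s : seq ('rV[R]_3 * 'rV[R]_3),
    A = [set x | exists2 ab, ab \in s & segment ab.1 ab.2 x].

Definition tame A : Prop :=
  exists2 h : 'rV[R]_3 -> 'rV[R]_3, homeomorphism h & polygonal (h @` A).

Definition unit_circle : set 'rV[R]_3 :=
  [set p | xcoord p ^+ 2 + ycoord p ^+ 2 = 1 /\ zcoord p = 0].

(* Equivalence of knots and of links is up to a self-homeomorphism of R^3.
   Orientation-preserving homeomorphisms (equivalently, ambient isotopies)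
   give the same notions of trivial knot and of split link, because the unit
   circle and both half-spaces below are invariant under the reflection
   x |-> -x. *)
Definition trivial_knot K : Prop :=
  exists2 h : 'rV[R]_3 -> 'rV[R]_3, homeomorphism h & h @` K = unit_circle.

(* Two disjoint closed curves are non-trivially linked when they do not form a
   split link. *)
Definition split_link A B : Prop :=
  exists h : 'rV[R]_3 -> 'rV[R]_3,
    [/\ homeomorphism h,
        h @` A `<=` [set p | zcoord p < 0] &
        h @` B `<=` [set p | 0 < zcoord p]].

End Knots.

Section Intrinsic.
Variables (R : realType) (G : sgraph).

(* As |G| is compact, a continuous injection is a homeomorphism onto its
   image. *)
Definition tame_embedding (f : 'rV[R]_#|G| -> 'rV[R]_3) : Prop :=
  [/\ {within realization R G, continuous f},
      {in realization R G &, injective f} &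
      tame (f @` realization R G)].

Definition intrinsically_knotted : Prop :=
  forall f : 'rV[R]_#|G| -> 'rV[R]_3, tame_embedding f ->
    exists2 c : seq G,
      graph_cycle c & ~ trivial_knot (f @` cycle_realization R c).

Definition intrinsically_linked : Prop :=
  forall f : 'rV[R]_#|G| -> 'rV[R]_3, tame_embedding f ->
    exists c d : seq G,
      [/\ graph_cycle c, graph_cycle d,
          forall u : G, u \in c -> u \notin d &
          ~ split_link (f @` cycle_realization R c)
                       (f @` cycle_realization R d)].

End Intrinsic.

(* Main.v *)
(* If the complement of a graph on eight vertices contains a path with three
   edges or three disjoint edges, then the graph has a straight-line embedding
   with vertices at suitable integer points (close to a planar drawing with two
   apices) all of whose cycles are unknotted: a cycle can be cut down to a
   triangle by repeatedly replacing two consecutive sides of an empty triangle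
   by the third one. So the complement of G, hence that of G - v, contains
   neither, which leaves so few edges in the complement that G - v contains K6,
   K6 with an edge subdivided, K(3,3,1), or the graph obtained from K6 by a
   triangle-star exchange. These graphs are intrinsically linked by the
   argument of Conway, Gordon and Sachs: a sum of mod 2 linking numbers over
   pairs of disjoint cycles reduces to a count of crossings in a projection,
   which is odd. Linking numbers are read off fine samplings of the cycles, by a
   formula which needs no general position; they vanish for split links because
   one component can be contracted away from the other. *)

From Stdlib Require Import BinInt.
Require Import Defs.
From mathcomp Require Import all_boot all_order all_algebra.
From mathcomp Require Import all_classical all_reals all_analysis.
From mathcomp Require Import ring lra zify ssrZ.

Set Implicit Arguments.
Unset Strict Implicit.
Unset Printing Implicit Defensive.

Import Order.TTheory GRing.Theory Num.Theory.
Import numFieldNormedType.Exports.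

(** * Homeomorphisms of space that straighten a corner *)

Section Straightening.
Local Open Scope classical_set_scope.
Local Open Scope ring_scope.

(** The two patterns excluded from the complement are the complements of the two planar
    triangulations with six vertices; the other two vertices of [G] become the apices. Triviality of
    a knot asks for a homeomorphism of the whole space, so each cut of a corner is realized by a
    piecewise linear map supported in a convex polyhedron around the empty triangle, and the choice
    of cuts is left to a finite computation with integer points.

    On the linking side an embedding is not compared with a standard one through crossing changes.
    For each fixed embedding, the crossings of two disjoint edges, counted with either one on top,
    telescope to bits that compare an edge or a vertex with an end vertex. In the sum over a
    certificate these bits cancel, up to an odd number of relations saying that of two vertices
    exactly one comes first in the projection. All that the fineness of a sampling must ensure is
    that small pieces of disjoint arcs are separated by a coordinate. *)

Lemma homeomorphism_comp (T : topologicalType) (h k : T -> T) :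
  homeomorphism h -> homeomorphism k -> homeomorphism (k \o h).
Proof.
move=> [hc [h' [h'c hK h'K]]] [kc [k' [k'c kK k'K]]]; split.
  by move=> x; apply: continuous_comp; [exact: hc | exact: kc].
exists (h' \o k'); split.
- by move=> x; apply: continuous_comp; [exact: k'c | exact: h'c].
- exact: can_comp.
- exact: can_comp.
Qed.

Lemma trivial_knot_homeo (R : realType) (h : 'rV[R]_3 -> 'rV[R]_3) K :
  homeomorphism h -> trivial_knot (h @` K) -> trivial_knot K.
Proof.
move=> hh [k kh kK]; exists (k \o h); first exact: homeomorphism_comp.
by rewrite image_comp in kK.
Qed.

Section ContinuousMaps.
Variables (R : realType) (T : topologicalType).

Lemma cont_id : continuous (@id T).
Proof. by move=> x; exact: cvg_id. Qed.

Lemma cont_add (V : normedModType R) (f g : T -> V) :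
  continuous f -> continuous g -> continuous (fun x => f x + g x).
Proof. by move=> fc gc x; apply: continuousD; [exact: fc | exact: gc]. Qed.

Lemma cont_opp (V : normedModType R) (f : T -> V) :
  continuous f -> continuous (fun x => - f x).
Proof. by move=> fc x; apply: continuousN; exact: fc. Qed.

Lemma cont_scale (V : normedModType R) (s : T -> R) (f : T -> V) :
  continuous s -> continuous f -> continuous (fun x => s x *: f x).
Proof. by move=> sc fc x; apply: continuousZ; [exact: sc | exact: fc]. Qed.

Lemma cont_mul (f g : T -> R) :
  continuous f -> continuous g -> continuous (fun x => f x * g x).
Proof. by move=> fc gc x; apply: continuousM; [exact: fc | exact: gc]. Qed.

Lemma cont_max (f g : T -> R) :
  continuous f -> continuous g -> continuous (fun x => Num.max (f x) (g x)).
Proof.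
by move=> fc gc x; apply: continuous_max; [exact: fc | exact: gc].
Qed.

Lemma cont_min (f g : T -> R) :
  continuous f -> continuous g -> continuous (fun x => Num.min (f x) (g x)).
Proof.
by move=> fc gc x; apply: continuous_min; [exact: fc | exact: gc].
Qed.

End ContinuousMaps.

Section AffineFunctionals.
Variable R : realType.
Implicit Types (p q : 'rV[R]_3) (k : R * R * R * R).

Definition aff k p : R :=
  k.1.1.1 + k.1.1.2 * xcoord p + k.1.2 * ycoord p + k.2 * zcoord p.

Lemma aff_push k p b m (t : R) :
  aff k (p + t *: (m - b)) = aff k p + t * (aff k m - aff k b).
Proof. by rewrite /aff /xcoord /ycoord /zcoord !mxE; ring. Qed.

Lemma aff_segment k p q (t : R) :
  aff k ((1 - t) *: p + t *: q) = (1 - t) * aff k p + t * aff k q.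
Proof. by rewrite /aff /xcoord /ycoord /zcoord !mxE; ring. Qed.

Lemma xcoord_continuous : continuous (@xcoord R).
Proof. by rewrite /xcoord; apply: coord_continuous. Qed.

Lemma ycoord_continuous : continuous (@ycoord R).
Proof. by rewrite /ycoord; apply: coord_continuous. Qed.

Lemma zcoord_continuous : continuous (@zcoord R).
Proof. by rewrite /zcoord; apply: coord_continuous. Qed.

Lemma aff_continuous k : continuous (aff k).
Proof.
apply: cont_add; last first.
  by apply: cont_mul; [exact: cst_continuous | exact: zcoord_continuous].
apply: cont_add; last first.
  by apply: cont_mul; [exact: cst_continuous | exact: ycoord_continuous].
apply: cont_add; first exact: cst_continuous.
by apply: cont_mul; [exact: cst_continuous | exact: xcoord_continuous].
Qed.

End AffineFunctionals.

(** * Pushing a point inside a convex polyhedron *)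

Section Push.
Variables (R : realType) (f0 : R * R * R * R) (fs : seq (R * R * R * R)).
Implicit Types (b m x : 'rV[R]_3).

Let inside b := forall f, f \in f0 :: fs -> 0 < aff f b.

Definition min_ratio b x : R :=
  foldr (fun f r => Num.min (aff f x / aff f b) r) (aff f0 x / aff f0 b) fs.

(* The map that fixes the exterior of the convex body where the functionals are
   nonnegative, and sends the ray from [b] to each boundary point linearly to the
   ray from [m]: [1 - min_ratio b x] is the gauge of the body centred at [b]. *)
Definition push b m x := x + Num.max 0 (min_ratio b x) *: (m - b).

Lemma min_ratioP b x (r : R) : inside b ->
  (forall f, f \in f0 :: fs -> r * aff f b <= aff f x) ->
  (exists2 f, f \in f0 :: fs & aff f x <= r * aff f b) ->
  min_ratio b x = r.
Proof.
move=> hb hle [f fin hf].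
have rE f' : f' \in f0 :: fs -> r <= aff f' x / aff f' b.
  by move=> fin'; rewrite ler_pdivlMr ?hb// hle.
have rf : aff f x / aff f b <= r by rewrite ler_pdivrMr ?hb.
apply/eqP; rewrite eq_le; apply/andP; split; last first.
  rewrite /min_ratio; have := rE f0 (mem_head _ _).
  have : forall f', f' \in fs -> r <= aff f' x / aff f' b.
    by move=> f' ?; apply: rE; rewrite inE; apply/orP; right.
  elim: fs => //= g s IH gs r0; rewrite le_min gs ?mem_head// IH//.
  by move=> f' f's; apply: gs; rewrite inE f's orbT.
apply: le_trans rf; rewrite /min_ratio; move: fin; rewrite inE.
case/orP => [/eqP->|].
  by elim: fs => //= g s IH; rewrite ge_min IH orbT.
elim: fs => //= g s IH; rewrite inE ge_min.
by case/orP => [/eqP->|/IH->]; rewrite ?lexx ?orbT.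
Qed.

Lemma min_ratio_le b x f : inside b -> f \in f0 :: fs ->
  min_ratio b x * aff f b <= aff f x.
Proof.
move=> hb fin; rewrite -ler_pdivlMr ?hb// /min_ratio; move: fin; rewrite inE.
case/orP => [/eqP->|].
  by elim: fs => //= g s IH; rewrite ge_min IH orbT.
elim: fs => //= g s IH; rewrite inE ge_min.
by case/orP => [/eqP->|/IH->]; rewrite ?lexx ?orbT.
Qed.

Lemma min_ratio_attained b x : inside b ->
  exists2 f, f \in f0 :: fs & aff f x = min_ratio b x * aff f b.
Proof.
move=> hb; have : exists2 f, f \in f0 :: fs & min_ratio b x = aff f x / aff f b.
  rewrite /min_ratio; elim: fs => [|g s [f fin IH]] /=.
    by exists f0; rewrite ?mem_head.
  case: (leP (aff g x / aff g b)) => _.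
    by exists g => //; rewrite !inE eqxx orbT.
  exists f => //; move: fin; rewrite !inE => /orP[->//|->].
  by rewrite !orbT.
by move=> [f fin ->]; exists f => //; rewrite divfK// gt_eqF// hb.
Qed.

Lemma push_id b m x : inside b ->
  (exists2 f, f \in f0 :: fs & aff f x <= 0) -> push b m x = x.
Proof.
move=> hb [f fin hf]; rewrite /push max_l ?scale0r ?addr0//.
have := le_trans (min_ratio_le x hb fin) hf.
by rewrite pmulr_lle0// hb.
Qed.

(** A positive ratio [r] at [x] survives the move: afterwards each functional is at least
    [r * aff f m], with equality for the one that attained the minimum, so the reverse push travels
    the same way back. If the ratio is not positive, both maps fix [x]. *)
Lemma pushK b m : inside b -> inside m -> cancel (push b m) (push m b).
Proof.
move=> hb hm x; have [f fin fE] := min_ratio_attained x hb.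
have [r0|r0] := leP (min_ratio b x) 0.
  have ex0 : exists2 f, f \in f0 :: fs & aff f x <= 0.
    by exists f => //; rewrite fE pmulr_lle0// hb.
  by rewrite (push_id m hb)// (push_id b hm).
have maxE : Num.max 0 (min_ratio b x) = min_ratio b x by rewrite max_r// ltW.
rewrite {1}/push (@min_ratioP _ _ (min_ratio b x)) //.
- by rewrite /push maxE -(opprB b m) scalerN addrNK.
- move=> g gin; rewrite /push maxE aff_push mulrBr.
  by rewrite addrCA lerDl subr_ge0 min_ratio_le.
- by exists f => //; rewrite /push maxE aff_push fE mulrBr addrC subrK.
Qed.

Lemma min_ratio_continuous b : continuous (min_ratio b).
Proof.
have hc f : continuous (fun x => aff f x / aff f b).
  by apply: cont_mul; [exact: aff_continuous | exact: cst_continuous].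
rewrite /min_ratio; elim: fs => [|g s IH] /=; first exact: hc.
by apply: cont_min; [exact: hc | exact: IH].
Qed.

Lemma push_continuous b m : continuous (push b m).
Proof.
apply: cont_add; first exact: cont_id.
apply: cont_scale; last exact: cst_continuous.
by apply: cont_max; [exact: cst_continuous | exact: min_ratio_continuous].
Qed.

Lemma push_homeomorphism b m : inside b -> inside m -> homeomorphism (push b m).
Proof.
move=> hb hm; split; first exact: push_continuous.
exists (push m b); split; [exact: push_continuous|exact: pushK|exact: pushK].
Qed.

(** Each functional is at least [(1 - t) * aff f b] on the ray, with equality for the one vanishing
    at [a], so the ratio is [1 - t]. *)
Lemma push_ray b m a (t : R) : inside b -> 0 <= t <= 1 ->
  (forall f, f \in f0 :: fs -> 0 <= aff f a) ->
  (exists2 f, f \in f0 :: fs & aff f a = 0) ->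
  push b m ((1 - t) *: b + t *: a) = (1 - t) *: m + t *: a.
Proof.
move=> hb /andP[t0 t1] ha [f fin fa]; rewrite /push (@min_ratioP _ _ (1 - t))//.
- rewrite max_r ?subr_ge0// scalerBr; apply/rowP => i; rewrite !mxE; ring.
- by move=> g gin; rewrite aff_segment lerDl mulr_ge0// ha.
- by exists f => //; rewrite aff_segment fa mulr0 addr0.
Qed.

End Push.

Lemma segmentP (R : realType) n (a b x : 'rV[R]_n) :
  segment a b x <-> exists2 t : R, 0 <= t <= 1 & x = (1 - t) *: a + t *: b.
Proof.
split=> [[t /=]|[t t01 ->]]; first by rewrite in_itv /= => t01 <-; exists t.
by exists t => //=; rewrite in_itv.
Qed.

Section Polygons.
Variables (R : realType) (T : eqType) (P : T -> 'rV[R]_3).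

Definition polygon (E : seq (T * T)) : set 'rV[R]_3 :=
  [set x | exists2 e, e \in E & segment (P e.1) (P e.2) x].

Lemma eq_polygon E F : E =i F -> polygon E = polygon F.
Proof.
by move=> EF; apply/seteqP; split=> x [e ein ex]; exists e => //;
  rewrite ?EF // -EF.
Qed.

(** One of [a] and [c] may lie on the plane, but the positive sum puts the midpoint of [ac] strictly
    on the side of [b]. *)
Definition separates (k : R * R * R * R) (a b c p q : 'rV[R]_3) :=
  [&& 0 < aff k b, 0 <= aff k a, 0 <= aff k c, 0 < aff k a + aff k c,
      aff k p <= 0 & aff k q <= 0].

(* The triangle [abc] meets the rest of the polygon only in [a] and [c], so
   pushing [b] to the midpoint of [ac] straightens the corner at [b]. *)
Lemma trivial_polygon_cut (a b c : T) F :
  (forall e, e \in F ->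
     exists k, separates k (P a) (P b) (P c) (P e.1) (P e.2)) ->
  (exists2 e, e \in F & a \in [:: e.1; e.2]) ->
  (exists2 e, e \in F & c \in [:: e.1; e.2]) ->
  trivial_knot (polygon ((a, c) :: F)) ->
  trivial_knot (polygon [:: (a, b), (b, c) & F]).
Proof.
move=> sepF [ea eaF aea] [ec ecF cec] triv.
(* One half-space for each edge of [F]: their intersection is the polyhedron, and [F] avoids its
   interior. *)
have [ks ks1 ks2] : exists2 ks : seq (R * R * R * R),
    forall k, k \in ks -> [/\ 0 < aff k (P b), 0 <= aff k (P a),
      0 <= aff k (P c) & 0 < aff k (P a) + aff k (P c)] &
    forall e, e \in F ->
      exists2 k, k \in ks & (aff k (P e.1) <= 0) && (aff k (P e.2) <= 0).
  elim: F sepF {triv ea eaF aea ec ecF cec} => [|e F IH] sepF.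
    by exists [::].
  have [|ks ks1 ks2] := IH.
    by move=> e' e'F; apply: sepF; rewrite inE e'F orbT.
  have [k /and5P[kb ka kc kac /andP[k1 k2]]] := sepF e (mem_head _ _).
  exists (k :: ks) => [k'|e']; rewrite inE => /orP[/eqP->//|].
  - exact: ks1.
  - by exists k; rewrite ?mem_head// k1.
  - by move=> /ks2[k' k'in k'e]; exists k' => //; rewrite inE k'in orbT.
pose m := (1 - 2^-1) *: P a + 2^-1 *: P c.
have mE k : aff k m = (aff k (P a) + aff k (P c)) / 2.
  by rewrite aff_segment; lra.
case: ks => [|k0 ks] in ks1 ks2 *; first by have [] := ks2 _ eaF.
have hb k : k \in k0 :: ks -> 0 < aff k (P b) by case/ks1.
have hm k : k \in k0 :: ks -> 0 < aff k m.
  by case/ks1 => _ _ _ ?; rewrite mE divr_gt0.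
have ha k : k \in k0 :: ks -> 0 <= aff k (P a) by case/ks1.
have hc k : k \in k0 :: ks -> 0 <= aff k (P c) by case/ks1.
(* The functional of the edge of [F] ending in [a] is both nonnegative and nonpositive there, so [a]
   is on the boundary; likewise for [c]. *)
have ha0 : exists2 k, k \in k0 :: ks & aff k (P a) = 0.
  have [k kin /andP[k1 k2]] := ks2 _ eaF; exists k => //; apply/eqP.
  by rewrite eq_le ha// andbT; move: aea; rewrite !inE => /orP[]/eqP->.
have hc0 : exists2 k, k \in k0 :: ks & aff k (P c) = 0.
  have [k kin /andP[k1 k2]] := ks2 _ ecF; exists k => //; apply/eqP.
  by rewrite eq_le hc// andbT; move: cec; rewrite !inE => /orP[]/eqP->.
pose h := push k0 ks (P b) m.
have hF e x : e \in F -> segment (P e.1) (P e.2) x -> h x = x.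
  move=> eF /segmentP[t /andP[t0 t1] ->]; apply: push_id => //.
  have [k kin /andP[k1 k2]] := ks2 _ eF; exists k => //.
  rewrite aff_segment; have := mulr_ge0_le0 t0 k2.
  by have : (1 - t) * aff k (P e.1) <= 0;
    [apply: mulr_ge0_le0; rewrite ?subr_ge0|lra].
have hab t : 0 <= t <= 1 ->
    h ((1 - t) *: P b + t *: P a) = (1 - t) *: m + t *: P a.
  by move=> t01; apply: push_ray.
have hcb t : 0 <= t <= 1 ->
    h ((1 - t) *: P b + t *: P c) = (1 - t) *: m + t *: P c.
  by move=> t01; apply: push_ray.
apply: (@trivial_knot_homeo _ h); first exact: push_homeomorphism.
suff -> : h @` polygon [:: (a, b), (b, c) & F] = polygon ((a, c) :: F) by [].
apply/seteqP; split => [_ [x [e + ex] <-]|x [e]].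
  move: ex => /[swap]; rewrite !in_cons => /or3P[/eqP->|/eqP->|eF] /=; last first.
  - by move=> ex; rewrite (hF e)//; exists e => //; rewrite in_cons eF orbT.
  - move=> /segmentP[t t01 ->]; rewrite hcb//; exists (a, c); first exact: mem_head.
    apply/segmentP; exists (2^-1 + t / 2); first by lra.
    by apply/rowP => i; rewrite !mxE; field.
  - move=> /segmentP[t t01 ->]; rewrite addrC.
    have -> : t *: P b = (1 - (1 - t)) *: P b by rewrite subKr.
    rewrite hab; last by lra.
    exists (a, c); first exact: mem_head.
    apply/segmentP; exists (t / 2); first by lra.
    by apply/rowP => i; rewrite !mxE; field.
rewrite in_cons => /orP[/eqP->|eF] /=; last first.
  move=> ex; exists x; last exact: (hF e).
  by exists e => //; rewrite !in_cons eF !orbT.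
(* As [m] is the midpoint, the first half of [ac] comes from [ab] and the second from [bc]. *)
move=> /segmentP[s s01 ->]; have [s2|s2] := leP s 2^-1.
  exists ((1 - (1 - 2 * s)) *: P b + (1 - 2 * s) *: P a).
    exists (a, b); rewrite ?mem_head//; apply/segmentP; exists (2 * s); first by lra.
    by apply/rowP => i; rewrite !mxE; ring.
  rewrite hab; last by lra.
  by apply/rowP => i; rewrite !mxE; field.
exists ((1 - (2 * s - 1)) *: P b + (2 * s - 1) *: P c).
  exists (b, c); rewrite ?inE ?eqxx ?orbT//; apply/segmentP.
  by exists (2 * s - 1) => //; lra.
rewrite hcb; last by lra.
by apply/rowP => i; rewrite !mxE; field.
Qed.

End Polygons.

(** Where [b] vanishes the quotient may jump, but it stays bounded while [X] tends to 0. *)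
Lemma continuous_ratio (R : realType) (T : topologicalType) (a b X : T -> R)
    (C : R) :
  continuous a -> continuous b -> continuous X -> (forall p, 0 <= b p) ->
  (forall p, 0 <= a p <= C * b p) -> (forall p, b p = 0 -> X p = 0) ->
  continuous (fun p => a p / b p * X p).
Proof.
move=> ac bc Xc bge0 abC bX p.
have [b0|b0] := eqVneq (b p) 0; last first.
  apply: (@continuousM R T (fun p => a p / b p) X p); last exact: Xc.
  apply: (@continuousM R T a (fun p => (b p)^-1) p); first exact: ac.
  exact: (@continuousV R T b p b0 (bc p)).
have ab q : 0 <= a q / b q <= `|C|.
  have /andP[a0 aC] := abC q.
  have [->|bq] := eqVneq (b q) 0; first by rewrite invr0 mulr0 lexx normr_ge0.
  have bp : 0 < b q by rewrite lt_neqAle eq_sym bq bge0.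
  rewrite divr_ge0//= ler_pdivrMr// (le_trans aC)//.
  by rewrite ler_pM2r// ler_norm.
have Xp : X p = 0 by exact: bX.
have lim0 : (fun q => `|C| * `|X q|) x @[x --> p] --> (0 : R).
  have -> : 0 = `|C| * `|X p| by rewrite Xp normr0 mulr0.
  apply: (@cont_mul R T (cst `|C|) (fun q => `|X q|)).
    exact: cst_continuous.
  by move=> q; apply: (cvg_norm (Xc q)).
rewrite /continuous_at Xp mulr0; apply: norm_cvg0.
apply: (squeeze_cvgr _ _ lim0); last exact: cvg_cst.
apply: nearW => q; rewrite normr_ge0 normrM ler_wpM2r// ger0_norm//.
  by case/andP: (ab q).
by case/andP: (ab q).
Qed.

(** * Radial maps between a triangle and the unit circle *)

Section Radial.
Variable R : realType.
Implicit Types p : 'rV[R]_3.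

Definition pt (x y z : R) : 'rV[R]_3 :=
  x *: delta_mx 0 (inord 0) + y *: delta_mx 0 (inord 1) +
  z *: delta_mx 0 (inord 2).

Lemma xcoord_pt x y z : xcoord (pt x y z) = x.
Proof.
by rewrite /xcoord !mxE -!val_eqE /= !inordK// mulr1 !mulr0 !addr0.
Qed.

Lemma ycoord_pt x y z : ycoord (pt x y z) = y.
Proof.
by rewrite /ycoord !mxE -!val_eqE /= !inordK// mulr1 !mulr0 add0r addr0.
Qed.

Lemma zcoord_pt x y z : zcoord (pt x y z) = z.
Proof.
by rewrite /zcoord !mxE -!val_eqE /= !inordK// mulr1 !mulr0 !add0r.
Qed.

Definition coord_pt := (xcoord_pt, ycoord_pt, zcoord_pt).

Lemma pt_eq p q : xcoord p = xcoord q -> ycoord p = ycoord q ->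
  zcoord p = zcoord q -> p = q.
Proof.
move=> hx hy hz; apply/rowP => i.
have -> : i = inord i by rewrite inord_val.
by case: i => -[|[|[|//]]].
Qed.

Lemma pt_coord p : p = pt (xcoord p) (ycoord p) (zcoord p).
Proof. by apply: pt_eq; rewrite coord_pt. Qed.

Lemma pt_continuous (T : topologicalType) (X Y Z : T -> R) :
  continuous X -> continuous Y -> continuous Z ->
  continuous (fun t => pt (X t) (Y t) (Z t)).
Proof.
move=> Xc Yc Zc; apply: cont_add; first apply: cont_add;
  by apply: cont_scale => //; exact: cst_continuous.
Qed.

Implicit Types a b : R -> R -> R.

(** A positively homogeneous gauge on the plane. Symmetry is not imposed, since the gauge of a
    triangle lacks it. *)
Definition gauge a :=
  [/\ continuous (fun p => a (xcoord p) (ycoord p)),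
      forall x y, 0 <= a x y,
      forall x y, a x y = 0 -> x = 0 /\ y = 0 &
      forall r x y, 0 <= r -> a (r * x) (r * y) = r * a x y].

(** Level curves of [a] are carried to level curves of [b] along the rays from the z-axis. The axis
    is fixed: the factor is 0 / 0, which is 0, but the coordinates that it multiplies vanish
    there. *)
Definition radial a b p :=
  let x := xcoord p in let y := ycoord p in
  pt (a x y / b x y * x) (a x y / b x y * y) (zcoord p).

Lemma radial_continuous a b (C : R) : gauge a -> gauge b ->
  (forall x y, a x y <= C * b x y) -> continuous (radial a b).
Proof.
move=> [ac a0 aE ah] [bc b0 bE bh] abC.
have ab p : 0 <= a (xcoord p) (ycoord p) <= C * b (xcoord p) (ycoord p).
  by rewrite a0 abC.
apply: pt_continuous; last exact: zcoord_continuous.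
- by apply: (continuous_ratio _ _ _ _ ab) => // [|p /bE[]//];
    exact: xcoord_continuous.
- by apply: (continuous_ratio _ _ _ _ ab) => // [|p /bE[]//];
    exact: ycoord_continuous.
Qed.

Lemma gauge0 a : gauge a -> a 0 0 = 0.
Proof.
by move=> [_ _ _ ah]; rewrite -[in LHS](mul0r (0 : R)) ah// mul0r.
Qed.

Lemma gauge_radial a b p : gauge a -> gauge b ->
  b (xcoord (radial a b p)) (ycoord (radial a b p)) = a (xcoord p) (ycoord p).
Proof.
move=> ga gb; have [ac a0 aE ah] := ga; have [bc b0 bE bh] := gb.
rewrite /radial !coord_pt bh; last by rewrite divr_ge0.
have [b00|?] := eqVneq (b (xcoord p) (ycoord p)) 0; last by rewrite divfK.
by have [-> ->] := bE _ _ b00; rewrite !gauge0// !mul0r.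
Qed.

Lemma radialK a b : gauge a -> gauge b -> cancel (radial a b) (radial b a).
Proof.
move=> ga gb p; have [ac a0 aE ah] := ga; have [bc b0 bE bh] := gb.
have bE' := gauge_radial p ga gb.
rewrite {1}/radial bE'; have aE' :
    a (xcoord (radial a b p)) (ycoord (radial a b p)) =
    a (xcoord p) (ycoord p) / b (xcoord p) (ycoord p) * a (xcoord p) (ycoord p).
  by rewrite /radial !coord_pt ah// divr_ge0.
rewrite aE' /radial !coord_pt; apply: pt_eq; rewrite !coord_pt//.
- have [b00|bn] := eqVneq (b (xcoord p) (ycoord p)) 0.
    by have [-> _] := bE _ _ b00; rewrite !mulr0.
  have [a00|an] := eqVneq (a (xcoord p) (ycoord p)) 0.
    by have [-> _] := aE _ _ a00; rewrite !mulr0.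
  by field; rewrite bn an.
- have [b00|bn] := eqVneq (b (xcoord p) (ycoord p)) 0.
    by have [_ ->] := bE _ _ b00; rewrite !mulr0.
  have [a00|an] := eqVneq (a (xcoord p) (ycoord p)) 0.
    by have [_ ->] := aE _ _ a00; rewrite !mulr0.
  by field; rewrite bn an.
Qed.

(** The unit curve is the triangle with vertices (-1/3, -1/3), (2/3, -1/3), (-1/3, 2/3), whose
    centroid is the origin. *)
Definition triangle_gauge (x y : R) : R :=
  Num.max (- 3 * x) (Num.max (- 3 * y) (3 * (x + y))).

Definition euclid_gauge (x y : R) : R := Num.sqrt (x ^+ 2 + y ^+ 2).

Lemma triangle_gauge_le x y r : (triangle_gauge x y <= r) =
  [&& - 3 * x <= r, - 3 * y <= r & 3 * (x + y) <= r].
Proof. by rewrite /triangle_gauge !ge_max. Qed.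

Lemma triangle_gaugeP : gauge triangle_gauge.
Proof.
split.
- apply: cont_max.
    by apply: cont_mul; [exact: cst_continuous|exact: xcoord_continuous].
  apply: cont_max.
    by apply: cont_mul; [exact: cst_continuous|exact: ycoord_continuous].
  apply: cont_mul; first exact: cst_continuous.
  by apply: cont_add; [exact: xcoord_continuous|exact: ycoord_continuous].
- move=> x y; have : triangle_gauge x y <= triangle_gauge x y by [].
  by rewrite {1}triangle_gauge_le => /and3P[]; lra.
- move=> x y; have : triangle_gauge x y <= triangle_gauge x y by [].
  rewrite {1}triangle_gauge_le => /and3P[h1 h2 h3] h.
  by rewrite h in h1 h2 h3; split; lra.
- move=> r x y r0; rewrite /triangle_gauge !maxr_pMr//.
  by congr Num.max; [ring|congr Num.max; ring].
Qed.

Lemma euclid_gauge_sqr x y : euclid_gauge x y ^+ 2 = x ^+ 2 + y ^+ 2.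
Proof. by rewrite sqr_sqrtr// addr_ge0// sqr_ge0. Qed.

Lemma euclid_gaugeP : gauge euclid_gauge.
Proof.
split.
- have c : continuous (fun p => xcoord p ^+ 2 + ycoord p ^+ 2).
    by apply: cont_add; apply: cont_mul;
      do ?[exact: xcoord_continuous|exact: ycoord_continuous].
  by move=> p; exact: (continuous_comp (c p) (@sqrt_continuous R _)).
- by move=> x y; exact: sqrtr_ge0.
- move=> x y h; have /eqP := euclid_gauge_sqr x y.
  rewrite h expr0n /= eq_sym paddr_eq0 ?sqr_ge0// !sqrf_eq0.
  by case/andP => /eqP-> /eqP->.
- move=> r x y r0; rewrite /euclid_gauge !exprMn -mulrDr sqrtrM ?sqr_ge0//.
  by rewrite sqrtr_sqr ger0_norm.
Qed.

(** This bound and the next are crude; they make [radial] continuous on the axis, in the two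
    directions. *)
Lemma triangle_euclid x y : triangle_gauge x y <= 6 * euclid_gauge x y.
Proof.
have h1 : `|x| <= euclid_gauge x y.
  by rewrite -(sqrtr_sqr x) ler_wsqrtr// lerDl sqr_ge0.
have h2 : `|y| <= euclid_gauge x y.
  by rewrite -(sqrtr_sqr y) ler_wsqrtr// lerDr sqr_ge0.
move: h1 h2; rewrite !ler_norml => /andP[? ?] /andP[? ?].
by rewrite triangle_gauge_le; apply/and3P; split; lra.
Qed.

Lemma euclid_triangle x y : euclid_gauge x y <= 2 * triangle_gauge x y.
Proof.
have := lexx (triangle_gauge x y); rewrite {1}triangle_gauge_le.
move: (triangle_gauge x y) => g /and3P[h1 h2 h3].
have g0 : 0 <= 2 * g by lra.
rewrite -(@ler_pXn2r _ 2)// ?nnegrE ?sqrtr_ge0// euclid_gauge_sqr.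
by nra.
Qed.

End Radial.

Lemma image_segment (R : realType) (m n : nat) (k : 'rV[R]_m -> 'rV[R]_n) :
  (forall (a b : 'rV[R]_m) (t : R),
     k ((1 - t) *: a + t *: b) = (1 - t) *: k a + t *: k b) ->
  forall a b, k @` segment a b = segment (k a) (k b).
Proof.
move=> kaff a b; apply/seteqP; split=> [_ [x /segmentP[t t01 ->] <-]|x].
  by apply/segmentP; exists t.
move=> /segmentP[t t01 ->]; exists ((1 - t) *: a + t *: b) => //.
by apply/segmentP; exists t.
Qed.

Lemma continuous_sum (R : realType) (V : normedModType R) (T : topologicalType)
    (I : Type) (r : seq I) (F : I -> T -> V) :
  (forall i, continuous (F i)) -> continuous (fun x => \sum_(i <- r) F i x).
Proof.
move=> Fc; elim: r => [|i r IH].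
  by under eq_fun do rewrite big_nil; exact: cst_continuous.
under eq_fun do rewrite big_cons.
by apply: cont_add; [exact: Fc|exact: IH].
Qed.

Lemma mulmx_continuous (R : realType) (m n : nat) (A : 'M[R]_(m, n.+1)) :
  continuous (fun x : 'rV[R]_m => x *m A).
Proof.
under eq_fun do rewrite mulmx_sum_row.
apply: continuous_sum => i; apply: cont_scale; last exact: cst_continuous.
exact: coord_continuous.
Qed.

(** * Affine frames and the unknotted triangle *)

Section Triangle.
Variable R : realType.
Implicit Types a b c d g p : 'rV[R]_3.

Definition frame g (u v w : 'rV[R]_3) p : 'rV[R]_3 :=
  g + (xcoord p *: u + ycoord p *: v + zcoord p *: w).

Lemma frame_continuous g u v w : continuous (frame g u v w).
Proof.
apply: cont_add; first exact: cst_continuous.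
apply: cont_add; first apply: cont_add;
  (apply: cont_scale; last exact: cst_continuous).
- exact: xcoord_continuous.
- exact: ycoord_continuous.
- exact: zcoord_continuous.
Qed.

Lemma xcoord_frame g u v w p : xcoord (frame g u v w p) =
  xcoord g + xcoord p * xcoord u + ycoord p * xcoord v + zcoord p * xcoord w.
Proof. by rewrite /xcoord !mxE !addrA. Qed.

Lemma ycoord_frame g u v w p : ycoord (frame g u v w p) =
  ycoord g + xcoord p * ycoord u + ycoord p * ycoord v + zcoord p * ycoord w.
Proof. by rewrite /ycoord !mxE !addrA. Qed.

Lemma zcoord_frame g u v w p : zcoord (frame g u v w p) =
  zcoord g + xcoord p * zcoord u + ycoord p * zcoord v + zcoord p * zcoord w.
Proof. by rewrite /zcoord !mxE !addrA. Qed.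

Definition coord_frame := (xcoord_frame, ycoord_frame, zcoord_frame).

Lemma xcoord_sub p q : xcoord (p - q) = xcoord p - xcoord q.
Proof. by rewrite /xcoord !mxE. Qed.

Lemma ycoord_sub p q : ycoord (p - q) = ycoord p - ycoord q.
Proof. by rewrite /ycoord !mxE. Qed.

Lemma zcoord_sub p q : zcoord (p - q) = zcoord p - zcoord q.
Proof. by rewrite /zcoord !mxE. Qed.

Definition coord_sub := (xcoord_sub, ycoord_sub, zcoord_sub).

Definition volume (u v w : 'rV[R]_3) : R :=
  xcoord u * (ycoord v * zcoord w - ycoord w * zcoord v)
  - ycoord u * (xcoord v * zcoord w - xcoord w * zcoord v)
  + zcoord u * (xcoord v * ycoord w - xcoord w * ycoord v).

Lemma volume_continuous (T : topologicalType) (u v w : T -> 'rV[R]_3) :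
  continuous u -> continuous v -> continuous w ->
  continuous (fun t => volume (u t) (v t) (w t)).
Proof.
move=> uc vc wc.
have x (f : T -> 'rV[R]_3) : continuous f -> continuous (fun t => xcoord (f t)).
  by move=> fc t; exact: continuous_comp (fc t) (@xcoord_continuous R _).
have y (f : T -> 'rV[R]_3) : continuous f -> continuous (fun t => ycoord (f t)).
  by move=> fc t; exact: continuous_comp (fc t) (@ycoord_continuous R _).
have z (f : T -> 'rV[R]_3) : continuous f -> continuous (fun t => zcoord (f t)).
  by move=> fc t; exact: continuous_comp (fc t) (@zcoord_continuous R _).
have minor (a b c d : T -> R) : continuous a -> continuous b -> continuous c ->
    continuous d -> continuous (fun t => a t * b t - c t * d t).
  move=> ac bc cc dc; apply: cont_add; first exact: cont_mul.
  by apply: cont_opp; exact: cont_mul.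
apply: cont_add; first apply: cont_add; last 1 first.
- by apply: cont_mul; [exact: z|apply: minor; [exact: x|exact: y|exact: x|exact: y]].
- by apply: cont_mul; [exact: x|apply: minor; [exact: y|exact: z|exact: y|exact: z]].
apply: cont_opp; apply: cont_mul; first exact: y.
by apply: minor; [exact: x|exact: z|exact: x|exact: z].
Qed.

(* Cramer's rule. *)
Lemma frame_homeomorphism g u v w :
  volume u v w != 0 -> homeomorphism (frame g u v w).
Proof.
move=> D0; split; first exact: frame_continuous.
have D0' := D0; rewrite /volume in D0'.
pose k p := pt (volume (p - g) v w / volume u v w)
  (volume u (p - g) w / volume u v w) (volume u v (p - g) / volume u v w).
have subc : continuous (fun p => p - g).
  by apply: cont_add; [exact: cont_id|exact: cst_continuous].
exists k; split.
- by apply: pt_continuous; apply: cont_mul; try exact: cst_continuous;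
    apply: volume_continuous => //; exact: cst_continuous.
- move=> p; apply: pt_eq; rewrite !coord_pt /volume !coord_sub !coord_frame;
    by field.
- move=> p; apply: pt_eq; rewrite !coord_frame !coord_pt;
    by rewrite /volume !coord_sub; field.
Qed.
Definition std_triangle : set 'rV[R]_3 :=
  [set p | triangle_gauge (xcoord p) (ycoord p) = 1 /\ zcoord p = 0].

Lemma trivial_std_triangle : trivial_knot std_triangle.
Proof.
have gt := @triangle_gaugeP R; have ge := @euclid_gaugeP R.
exists (radial (@triangle_gauge R) (@euclid_gauge R)).
  split; first exact: radial_continuous (@triangle_euclid R).
  exists (radial (@euclid_gauge R) (@triangle_gauge R)); split.
  - exact: radial_continuous (@euclid_triangle R).
  - exact: radialK.
  - exact: radialK.
have circE p : unit_circle p <->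
    euclid_gauge (xcoord p) (ycoord p) = 1 /\ zcoord p = 0.
  rewrite /unit_circle /= -euclid_gauge_sqr; split=> -[h ->]; split=> //.
    by apply/eqP; rewrite -(@eqrXn2 _ 2)// ?sqrtr_ge0// h expr1n.
  by rewrite h expr1n.
apply/seteqP; split=> [_ [p [p1 p0] <-]|p /circE[p1 p0]].
  by apply/circE; rewrite gauge_radial// p1 /radial coord_pt.
exists (radial (@euclid_gauge R) (@triangle_gauge R) p); last exact: radialK.
by rewrite /std_triangle /= gauge_radial// p1 /radial coord_pt.
Qed.

(** The vector [w] witnesses that the triangle is not degenerate, by completing two of its sides to
    a frame. *)
Lemma trivial_triangle a b c w : volume (b - a) (c - a) w != 0 ->
  trivial_knot (polygon id [:: (a, b); (b, c); (c, a)]).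
Proof.
move=> D0; pose g := a + 3^-1 *: (b - a) + 3^-1 *: (c - a).
pose k := frame g (b - a) (c - a) w.
have [kc [k' [k'c kK k'K]]] := frame_homeomorphism g D0.
apply: (@trivial_knot_homeo _ k'); first by split=> //; exists k.
suff -> : polygon id [:: (a, b); (b, c); (c, a)] = k @` std_triangle.
  rewrite image_comp (_ : k' \o k = id) ?image_id; last exact/funext.
  exact: trivial_std_triangle.
have kE x y : k (pt x y 0) = a + (x + 3^-1) *: (b - a) + (y + 3^-1) *: (c - a).
  by apply: pt_eq; rewrite coord_frame !coord_pt;
    rewrite /xcoord /ycoord /zcoord !mxE; ring.
apply/seteqP; split=> [p [e + /segmentP[t t01 ->]]|_ [p [p1 p0] <-]].
  have inT x y : [&& - 3 * x <= 1, - 3 * y <= 1 & 3 * (x + y) <= 1] ->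
      [|| - 3 * x == 1, - 3 * y == 1 | 3 * (x + y) == 1] ->
      std_triangle (pt x y 0).
    move=> h1 h2; rewrite /std_triangle /= !coord_pt; split=> //; apply/eqP.
    rewrite eq_le triangle_gauge_le h1 /= /triangle_gauge !le_max.
    by case/or3P: h2 => /eqP->; rewrite lexx ?orbT.
  rewrite !inE => /or3P[] /eqP-> /=.
  - exists (pt (t - 3^-1) (- 3^-1) 0).
      by apply: inT; [apply/and3P; split; lra|apply/or3P; apply: Or32; lra].
    by rewrite kE; apply/rowP => i; rewrite !mxE; ring.
  - exists (pt (1 - t - 3^-1) (t - 3^-1) 0).
      by apply: inT; [apply/and3P; split; lra|apply/or3P; apply: Or33; lra].
    by rewrite kE; apply/rowP => i; rewrite !mxE; ring.
  - exists (pt (- 3^-1) (1 - t - 3^-1) 0).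
      by apply: inT; [apply/and3P; split; lra|apply/or3P; apply: Or31; lra].
    by rewrite kE; apply/rowP => i; rewrite !mxE; ring.
rewrite (pt_coord p) p0 kE.
move: p1; set x := xcoord p; set y := ycoord p => p1.
have : triangle_gauge x y <= 1 by rewrite p1.
rewrite triangle_gauge_le => /and3P[h1 h2 h3].
have : [|| 1 <= - 3 * x, 1 <= - 3 * y | 1 <= 3 * (x + y)].
  by rewrite -!le_max -/(triangle_gauge x y) p1.
case/or3P => h.
- have -> : x = - 3^-1 by lra.
  exists (c, a); first by rewrite !inE eqxx !orbT.
  apply/segmentP; exists (2 / 3 - y); first by apply/andP; split; lra.
  by apply/rowP => i; rewrite !mxE; field.
- have -> : y = - 3^-1 by lra.
  exists (a, b); first by rewrite !inE eqxx.
  apply/segmentP; exists (x + 3^-1); first by apply/andP; split; lra.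
  by apply/rowP => i; rewrite !mxE; field.
- have -> : x = 3^-1 - y by lra.
  exists (b, c); first by rewrite !inE eqxx orbT.
  apply/segmentP; exists (y + 3^-1); first by apply/andP; split; lra.
  by apply/rowP => i; rewrite !mxE; field.
Qed.

End Triangle.

End Straightening.

(** * A reduction procedure for polygons with integer vertices *)

Section Tables.

Definition zpoint := (Z * Z * Z)%type.

Section Integral.
Local Open Scope Z_scope.
Implicit Types (a b c d p q n : zpoint).

Definition zsub a b : zpoint := (a.1.1 - b.1.1, a.1.2 - b.1.2, a.2 - b.2).

Definition zcross a b : zpoint :=
  (a.1.2 * b.2 - a.2 * b.1.2, a.2 * b.1.1 - a.1.1 * b.2,
   a.1.1 * b.1.2 - a.1.2 * b.1.1).

Definition zdot a b : Z := a.1.1 * b.1.1 + a.1.2 * b.1.2 + a.2 * b.2.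

Definition zplane p n : Z * Z * Z * Z := (- zdot n p, n.1.1, n.1.2, n.2).

Definition zaff (k : Z * Z * Z * Z) p : Z :=
  k.1.1.1 + k.1.1.2 * p.1.1 + k.1.2 * p.1.2 + k.2 * p.2.

Definition zopp (k : Z * Z * Z * Z) : Z * Z * Z * Z :=
  (- k.1.1.1, - k.1.1.2, - k.1.2, - k.2).

Definition zseparates k a b c p q : bool :=
  [&& 0 <? zaff k b, 0 <=? zaff k a, 0 <=? zaff k c, 0 <? zaff k a + zaff k c,
      zaff k p <=? 0 & zaff k q <=? 0].

(* If the line [pq] misses the triangle, then a plane through it parallel to one
   of the sides of the triangle separates; otherwise a plane through [p] or [q]
   parallel to the triangle does. *)
Definition zseparable a b c p q : bool :=
  let n := zcross (zsub b a) (zsub c a) in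
  let ks := [:: zplane p (zcross (zsub q p) (zsub b a));
                zplane p (zcross (zsub q p) (zsub c b));
                zplane p (zcross (zsub q p) (zsub a c));
                zplane p n; zplane q n] in
  has (fun k => zseparates k a b c p q || zseparates (zopp k) a b c p q) ks.

Definition zvolume a b c d : Z :=
  zdot (zsub b a) (zcross (zsub c a) (zsub d a)).

(* Perturbed planar drawings of the octahedron (K6 minus [miss1]) and of K6 minus
   the path [miss2], with two further vertices joined to everything. *)
Definition conf1 : seq zpoint := [:: (-1, 12, -1); (-1, -3, 1); (-11, -9, 0);
  (3, 0, 0); (13, -9, 1); (-3, 1, 0); (15, 5, 14); (13, 7, -15)].
Definition conf2 : seq zpoint := [:: (0, 0, -1); (0, 9, 1); (-1, -5, 1);
  (1, 4, -1); (13, -10, 1); (-11, -9, 0); (15, 7, 13); (14, 6, -13)].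

End Integral.

(* As opposed to [has], [lazy_has] stops at the first success under [vm_compute]. *)
Fixpoint lazy_has T (p : pred T) s : bool :=
  if s is x :: s' then (if p x then true else lazy_has p s') else false.

Lemma lazy_hasE T (p : pred T) s : lazy_has p s = has p s.
Proof. by elim: s => //= x s ->; case: (p x). Qed.

Section Reduction.
Local Open Scope nat_scope.
Variables (conf : seq zpoint) (miss : seq (nat * nat)).

Definition vert i : zpoint := nth (Z0, Z0, Z0) conf i.

Definition tabulate T (f : nat -> T) : seq T := mkseq f 8.

Definition sep_table : seq (seq (seq (seq (seq bool)))) :=
  tabulate (fun a => tabulate (fun b => tabulate (fun c => tabulate (fun p =>
  tabulate (fun q => zseparable (vert a) (vert b) (vert c) (vert p) (vert q)))))).

Definition missing i j : bool := ((i, j) \in miss) || ((j, i) \in miss).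

(* [table] is instantiated with [sep_table]; it is a parameter so that
   [vm_compute] evaluates it only once. *)
Section Table.
Variable table : seq (seq (seq (seq (seq bool)))).

Definition look a b c p q : bool :=
  nth false (nth [::] (nth [::] (nth [::] (nth [::] table a) b) c) p) q.

(** The rotation brings the corner to the front; asking for a fourth vertex [d] leaves at least a
    triangle. The zipped list consists of the edges other than [ab] and [bc]. *)
Definition try_cut (rec : seq nat -> bool) (l : seq nat) k : bool :=
  if rot k l is [:: a, b, c, d & r] then
    if all (fun e => look a b c e.1 e.2) (zip (c :: d :: r) (rcons (d :: r) a))
    then rec [:: a, c, d & r] else false
  else false.

(** The search backtracks over the corner to cut. A triangle is accepted when some point of the
    configuration is off its plane, which yields the third vector of [trivial_triangle]. *)
Fixpoint reducible n (l : seq nat) : bool :=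
  if l is [:: a; b; c] then
    lazy_has (fun d => ~~ Z.eqb (zvolume (vert a) (vert b) (vert c) (vert d)) Z0)
      (iota 0 8)
  else if n is n'.+1 then
    lazy_has (try_cut (reducible n') l) (iota 0 (size l))
  else false.

(** Nested conditionals replace connectives, whose arguments [vm_compute] would all evaluate. *)
Definition cycle_ok (l : seq nat) : bool :=
  if (size l < 3)%N then true
  else if missing (last 0%N l) (head 0%N l) then true else reducible 8 l.

Definition extension_ok (rec : seq nat -> bool) (l : seq nat) i : bool :=
  if i \in l then true
  else if (if l is j :: _ then missing i j else false) then true else rec (i :: l).

(** Paths of the graph are enumerated by growth at the head; a cycle is met as a path whose ends are
    joined. *)
Fixpoint cycles_ok n (l : seq nat) : bool :=
  if cycle_ok l then
    if n is n'.+1 then all (extension_ok (cycles_ok n') l) (iota 0 8) else true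
  else false.

End Table.

Definition config_ok : bool := cycles_ok sep_table 8 [::].

Definition normal i j k : zpoint :=
  zcross (zsub (vert j) (vert i)) (zsub (vert k) (vert i)).

(** Triples with a repeated index give the zero functional, which [has_plane] never accepts. *)
Definition planes : seq (Z * Z * Z * Z) :=
  flatten [seq flatten [seq [seq zplane (vert i) (normal i j k)
    | k <- iota j (8 - j)] | j <- iota i (8 - i)] | i <- iota 0 8].

Definition plane_values : seq (seq Z) :=
  [seq tabulate (fun i => zaff k (vert i)) | k <- planes].

(* The list of values of an affine functional at the eight points stands for the
   plane where it vanishes. *)
Definition has_plane (values : seq (seq Z)) k a b c : bool :=
  lazy_has (fun v => if Z.eqb (nth Z0 v k) Z0 then false else
    all (fun i => (i == k) || Z.eqb (nth Z0 v i) Z0) [:: a; b; c]) values.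

(** This rules out four coplanar points, and so keeps straight edges without a common end
    disjoint. *)
Definition general_position (values : seq (seq Z)) : bool :=
  all (fun k => all (fun a => all (fun b => all (has_plane values k a b)
    (iota 0 8)) (iota 0 8)) (iota 0 8)) (iota 0 8).

End Reduction.

Definition miss1 : seq (nat * nat) := [:: (0, 1); (2, 3); (4, 5)]%N.
Definition miss2 : seq (nat * nat) := [:: (0, 1); (1, 2); (2, 3)]%N.

#[global] Arguments reducible : simpl never.
#[global] Arguments cycles_ok : simpl never.
#[global] Arguments sep_table : simpl never.

Lemma config1_ok : config_ok conf1 miss1.
Proof. by vm_compute. Qed.

Lemma config2_ok : config_ok conf2 miss2.
Proof. by vm_compute. Qed.

Lemma general_position1 : general_position (plane_values conf1).
Proof. by vm_compute. Qed.

Lemma general_position2 : general_position (plane_values conf2).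
Proof. by vm_compute. Qed.


End Tables.

(** * Straight-line embeddings without knots *)

Section StraightGraphs.
Local Open Scope classical_set_scope.
Local Open Scope ring_scope.

Definition cyclic_pairs (T : Type) (l : seq T) := zip l (rot 1 l).

Lemma map_next (T : eqType) (c : seq T) : uniq c -> map (next c) c = rot 1 c.
Proof.
move=> uc; case: c uc => [|x c] // uc; rewrite rot1_cons.
apply: (@eq_from_nth _ x); first by rewrite size_map size_rcons.
move=> i; rewrite size_map => ic.
rewrite (nth_map x)// next_nth mem_nth// index_uniq// nth_rcons.
move: ic; rewrite /= ltnS leq_eqVlt => /orP[/eqP->|->//].
by rewrite ltnn eqxx nth_default.
Qed.

Lemma mem_cyclic_pairs (T : eqType) (c : seq T) e : uniq c ->
  (e \in cyclic_pairs c) = (e.1 \in c) && (e.2 == next c e.1).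
Proof.
move=> uc; rewrite /cyclic_pairs -map_next// -{1}(map_id c) zip_map.
apply/mapP/andP => [[u uc' ->]|[e1 /eqP e2]]; first by rewrite eqxx.
by exists e.1 => //; rewrite -e2 -surjective_pairing.
Qed.

Lemma cyclic_pairs_rot (T : eqType) k (l : seq T) :
  cyclic_pairs (rot k l) =i cyclic_pairs l.
Proof.
have rot_zip (s t : seq T) : size s = size t ->
    zip (rot k s) (rot k t) =i zip s t.
  move=> st e; have stk : size (drop k s) = size (drop k t).
    by rewrite !size_drop st.
  rewrite /rot zip_cat// mem_cat orbC -mem_cat -zip_cat ?cat_take_drop//.
  by rewrite !size_take st.
by rewrite /cyclic_pairs rot_rot; apply: rot_zip; rewrite size_rot.
Qed.

Lemma last_zip_rcons (T : eqType) (a c : T) s :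
  (last c s, a) \in zip (c :: s) (rcons s a).
Proof.
elim: s c => [|d s IH] c /=; first by rewrite mem_head.
by rewrite inE; apply/orP; right; exact: IH.
Qed.

Section IntegerPoints.
Variable R : realType.

Definition zr (z : Z) : R := (int_of_Z z)%:~R.

Lemma zrD x y : zr (Z.add x y) = zr x + zr y.
Proof. by rewrite /zr -rmorphD -(rmorphD int_of_Z). Qed.

Lemma zrN x : zr (Z.opp x) = - zr x.
Proof. by rewrite /zr -rmorphN -(rmorphN int_of_Z). Qed.

Lemma zrB x y : zr (Z.sub x y) = zr x - zr y.
Proof. by rewrite -zrN -zrD. Qed.

Lemma zrM x y : zr (Z.mul x y) = zr x * zr y.
Proof. by rewrite /zr -rmorphM -(rmorphM int_of_Z). Qed.

Lemma zr_ge0 z : Z.leb Z0 z -> 0 <= zr z.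
Proof. by rewrite /zr ler0z; case: z. Qed.

Lemma zr_gt0 z : Z.ltb Z0 z -> 0 < zr z.
Proof. by rewrite /zr ltr0z; case: z => //= p _; lia. Qed.

Lemma zr_le0 z : Z.leb z Z0 -> zr z <= 0.
Proof. by rewrite /zr lerz0; case: z. Qed.

Lemma zr_eq0 z : (zr z == 0) = Z.eqb z Z0.
Proof. by rewrite /zr intr_eq0; case: z => //= p; lia. Qed.

Definition zpt (p : zpoint) : 'rV[R]_3 := pt (zr p.1.1) (zr p.1.2) (zr p.2).

Definition zfun (k : Z * Z * Z * Z) : R * R * R * R :=
  (zr k.1.1.1, zr k.1.1.2, zr k.1.2, zr k.2).

Lemma aff_zfun k p : aff (zfun k) (zpt p) = zr (zaff k p).
Proof. by rewrite /aff /zaff !coord_pt !zrD !zrM. Qed.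

Lemma zseparates_sound k a b c p q : zseparates k a b c p q ->
  separates (zfun k) (zpt a) (zpt b) (zpt c) (zpt p) (zpt q).
Proof.
rewrite /zseparates /separates !aff_zfun -zrD.
case/and5P => /zr_gt0-> /zr_ge0-> /zr_ge0-> /zr_gt0->.
by case/andP => /zr_le0-> /zr_le0->.
Qed.

Lemma zseparable_sound a b c p q : zseparable a b c p q ->
  exists k, separates k (zpt a) (zpt b) (zpt c) (zpt p) (zpt q).
Proof.
by move=> /hasP[k _ /orP[]] /zseparates_sound; [exists (zfun k)|exists (zfun (zopp k))].
Qed.

Lemma volume_zpt a b c d :
  volume (zpt b - zpt a) (zpt c - zpt a) (zpt d - zpt a) = zr (zvolume a b c d).
Proof.
rewrite /volume /zvolume /zdot /zcross /zsub /= !coord_sub !coord_pt.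
by rewrite !(zrD, zrB, zrM); ring.
Qed.

End IntegerPoints.

Section ReductionSound.
Variables (R : realType) (conf : seq zpoint) (miss : seq (nat * nat)).

Definition rvert i : 'rV[R]_3 := zpt R (vert conf i).

Lemma look_sep_table a b c p q :
  all (gtn 8%N) [:: a; b; c; p; q] -> look (sep_table conf) a b c p q =
  zseparable (vert conf a) (vert conf b) (vert conf c) (vert conf p) (vert conf q).
Proof.
move=> /= /and5P[a8 b8 c8 p8 /andP[q8 _]].
by rewrite /look /sep_table /tabulate !nth_mkseq.
Qed.

Lemma reducible_sound n l : reducible conf (sep_table conf) n l ->
  all (gtn 8%N) l -> (2 < size l)%N -> trivial_knot (polygon rvert (cyclic_pairs l)).
Proof.
have tri a b c n' : reducible conf (sep_table conf) n' [:: a; b; c] ->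
    trivial_knot (polygon rvert (cyclic_pairs [:: a; b; c])).
  have -> : reducible conf (sep_table conf) n' [:: a; b; c] =
      lazy_has (fun d => ~~ Z.eqb (zvolume (vert conf a) (vert conf b)
        (vert conf c) (vert conf d)) Z0) (iota 0 8) by case: n'.
  rewrite lazy_hasE => /hasP[d _]; rewrite -(zr_eq0 R) -volume_zpt.
  move/trivial_triangle; congr trivial_knot; apply/seteqP; split=> x [e];
    rewrite !inE => /or3P[]/eqP-> /= xe; by
    [exists (a, b); rewrite ?mem_head|exists (b, c); rewrite ?inE ?eqxx ?orbT
    |exists (c, a); rewrite ?inE ?eqxx ?orbT
    |exists (rvert a, rvert b); rewrite ?mem_head
    |exists (rvert b, rvert c); rewrite ?inE ?eqxx ?orbT
    |exists (rvert c, rvert a); rewrite ?inE ?eqxx ?orbT].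
elim: n l => [|n IH] [|a1 [|a2 [|a3 [|a4 l]]]]//; do ?by move=> /tri.
set l' := [:: a1, a2, a3, a4 & l] => red l8 _.
have /hasP[k _] : has (try_cut (sep_table conf)
    (reducible conf (sep_table conf) n) l') (iota 0 (size l')).
  by rewrite -lazy_hasE.
rewrite -(eq_polygon _ (cyclic_pairs_rot k l')) /try_cut.
have : all (gtn 8%N) (rot k l') by rewrite (eq_all_r (mem_rot k l')).
case: (rot k l') => [|a [|b [|c [|d r]]]]// /and5P[a8 b8 c8 d8 r8].
have {a8 b8 c8 d8}[a8 b8 c8 d8] :
  [/\ (a < 8)%N, (b < 8)%N, (c < 8)%N & (d < 8)%N] by [].
case: ifP => // lookF /IH IHn.
pose F := zip (c :: d :: r) (rcons (d :: r) a).
have F8 e : e \in F -> (e.1 < 8)%N && (e.2 < 8)%N.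
  move=> eF; have cdr : all (gtn 8%N) (c :: d :: r) by apply/and3P.
  have dra : all (gtn 8%N) (rcons (d :: r) a) by rewrite all_rcons; apply/and3P.
  have := map_f fst eF; rewrite -/(unzip1 F) unzip1_zip ?size_rcons//.
  move=> /(allP cdr)/= ->; have := map_f snd eF.
  by rewrite -/(unzip2 F) unzip2_zip ?size_rcons// => /(allP dra).
rewrite /cyclic_pairs rot1_cons; apply: (@trivial_polygon_cut _ _ rvert a b c F).
- move=> e eF; have /andP[e1 e2] := F8 _ eF; apply: zseparable_sound.
  by have := allP lookF _ eF; rewrite look_sep_table//= a8 b8 c8 e1 e2.
(* The edges next to the corner: the closing one ends in [a], and [(c, d)] starts at [c]. *)
- by exists (last c (d :: r), a); [exact: last_zip_rcons|rewrite /= !inE eqxx orbT].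
- by exists (c, d); rewrite ?mem_head.
- by move: IHn; rewrite /cyclic_pairs rot1_cons; apply => //; apply/and4P.
Qed.

Definition present i j := ~~ missing miss i j.

Lemma cycles_ok_sound n l s : cycles_ok conf miss (sep_table conf) n l ->
  (size s <= n)%N -> uniq (s ++ l) -> all (gtn 8%N) s -> sorted present (s ++ l) ->
  cycle_ok conf miss (sep_table conf) (s ++ l).
Proof.
elim: n l s => [|n IH] l s.
  by case: s => //; rewrite /cycles_ok; case: ifP.
case/lastP: s => [|s i] ok; first by move: ok; rewrite /cycles_ok; case: ifP.
have {ok}/allP ok : all (extension_ok miss
    (cycles_ok conf miss (sep_table conf) n) l) (iota 0 8).
  by move: ok; rewrite /cycles_ok -/cycles_ok; case: ifP.
rewrite size_rcons ltnS all_rcons cat_rcons => sn us /andP[i8 s8] so.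
apply: IH => //; have := ok i; rewrite mem_iota => /(_ i8).
move: us; rewrite /extension_ok cat_uniq => /and3P[_ _ /andP[/negPf-> _]].
have /cat_sorted2[_] := so.
by case: l => [|j l] //= in ok so * => /andP[/negPf-> _].
Qed.

Lemma config_sound l : config_ok conf miss -> uniq l -> all (gtn 8%N) l ->
  (2 < size l)%N -> cycle present l ->
  trivial_knot (polygon rvert (cyclic_pairs l)).
Proof.
case: l => [|a l] // ok ul l8 l2 cl; apply: (@reducible_sound 8) => //.
have l8' : (size (a :: l) <= 8)%N.
  rewrite -(size_iota 0 8); apply: uniq_leq_size => // i /(allP l8).
  by rewrite mem_iota.
have : path present a (rcons l a) by exact: cl.
rewrite rcons_path => /andP[pl la].
have := cycles_ok_sound ok l8'; rewrite cats0 => /(_ ul l8 pl).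
by rewrite /cycle_ok ltnNge l2 /= [missing _ _ _](negPf la).
Qed.

End ReductionSound.

Lemma plane_values_sound (R : realType) conf v : v \in plane_values conf ->
  exists k, forall i, (i < 8)%N -> aff k (rvert R conf i) = zr R (nth Z0 v i).
Proof.
move=> /mapP[k _ ->]; exists (zfun R k) => i i8.
by rewrite aff_zfun /tabulate nth_mkseq.
Qed.

Lemma general_positionP values k a b c : general_position values ->
  all (gtn 8%N) [:: k; a; b; c] -> has_plane values k a b c.
Proof.
have in8 i : (i < 8)%N -> i \in iota 0 8 by rewrite mem_iota.
move=> + /and5P[k8 a8 b8 c8 _].
move=> /allP/(_ _ (in8 k k8))/allP/(_ _ (in8 a a8))/allP/(_ _ (in8 b b8)).
by move=> /allP/(_ _ (in8 c c8)).
Qed.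

Lemma general_position_sound (R : realType) conf k a b c :
  general_position (plane_values conf) -> all (gtn 8%N) [:: k; a; b; c] ->
  exists2 f, aff f (rvert R conf k) != 0 &
    forall i, i \in [:: a; b; c] -> i != k -> aff f (rvert R conf i) = 0.
Proof.
move=> gp kabc; have := general_positionP gp kabc.
case/and5P: kabc => k8 a8 b8 c8 _; rewrite /has_plane lazy_hasE => /hasP[v vin].
case: ifPn => // vk /allP hv; have [f hf] := plane_values_sound R vin.
exists f => [|i iabc ik]; first by rewrite hf// zr_eq0.
have := hv i iabc; rewrite (negPf ik) /= => vi; apply/eqP; rewrite hf ?zr_eq0//.
by move: iabc; rewrite !inE => /or3P[]/eqP->.
Qed.

Section StraightEmbedding.
Variables (R : realType) (G : sgraph) (conf : seq zpoint).
Variables (miss : seq (nat * nat)) (s : seq G) (x0 : G).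
Hypothesis s_size : size s = 8%N.
Hypothesis s_mem : forall v : G, v \in s.
Hypothesis s_miss :
  {in miss, forall p, ~~ sedge (nth x0 s p.1) (nth x0 s p.2)}.
Hypothesis conf_ok : config_ok conf miss.
Hypothesis conf_gp : general_position (plane_values conf).

Let lab (v : G) : nat := index v s.

Let lab8 v : (lab v < 8)%N.
Proof. by rewrite /lab -s_size index_mem. Qed.

Let lab_inj : injective lab.
Proof.
by move=> u v uv; rewrite -(nth_index x0 (s_mem u)) -/(lab u) uv nth_index.
Qed.

Let place v : 'rV[R]_3 := rvert R conf (lab v).

Let emb (x : 'rV[R]_#|G|) : 'rV[R]_3 :=
  x *m \matrix_(i < #|G|) place (enum_val i).

Let emb_vertex v : emb (vertex_pt R v) = place v.
Proof. by rewrite /emb /vertex_pt -rowE rowK enum_rankK. Qed.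

Let emb_affine (x y : 'rV[R]_#|G|) (t : R) :
  emb ((1 - t) *: x + t *: y) = (1 - t) *: emb x + t *: emb y.
Proof. by rewrite /emb mulmxDl -!scalemxAl. Qed.

Let emb_segment u v :
  emb @` segment (vertex_pt R u) (vertex_pt R v) = segment (place u) (place v).
Proof. by rewrite image_segment ?emb_vertex//; exact: emb_affine. Qed.

Let coord_aff f k u v (x : 'rV[R]_#|G|) :
  (forall w, w \in [:: u; v] -> w != k -> aff f (place w) = 0) ->
  segment (vertex_pt R u) (vertex_pt R v) x ->
  aff f (emb x) = x 0 (enum_rank k) * aff f (place k).
Proof.
move=> fw /segmentP[t t01 ->]; rewrite emb_affine aff_segment !emb_vertex !mxE /=.
have fE w : w \in [:: u; v] ->
    aff f (place w) = (enum_rank k == enum_rank w)%:R * aff f (place k).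
  move=> wuv; rewrite (inj_eq enum_rank_inj).
  have [->|kw] := eqVneq k w; first by rewrite mul1r.
  by rewrite mul0r fw// eq_sym.
rewrite (fE u) ?inE ?eqxx// (fE v) ?inE ?eqxx ?orbT//.
by ring.
Qed.

(** General position provides a functional that vanishes at the ends other than [u] but not at [u];
    by [coord_aff] it recovers the coordinate of [u] at both points from their common image. *)
Let coord_eq (x y : 'rV[R]_#|G|) u v u' v' :
  segment (vertex_pt R u) (vertex_pt R v) x ->
  segment (vertex_pt R u') (vertex_pt R v') y ->
  emb x = emb y -> x 0 (enum_rank u) = y 0 (enum_rank u).
Proof.
move=> xs ys xy.
have [f fu f0] := @general_position_sound R conf (lab u) (lab v) (lab u') (lab v')
  conf_gp (introT and5P (And5 (lab8 _) (lab8 _) (lab8 _) (lab8 _) isT)).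
have f0' w : w \in [:: u; v; u'; v'] -> w != u -> aff f (place w) = 0.
  move=> win wu; apply: f0; last by rewrite (inj_eq lab_inj).
  by move: win; rewrite inE (negPf wu) /= !inE => /or3P[]/eqP->; rewrite eqxx ?orbT.
apply: (mulIf fu); rewrite -(@coord_aff f u u v x)//; last first.
  by move=> w; rewrite !inE => /orP[]/eqP-> h; apply: f0'; rewrite // !inE eqxx ?orbT.
rewrite -(@coord_aff f u u' v' y) ?xy//.
by move=> w; rewrite !inE => /orP[]/eqP-> h; apply: f0'; rewrite // !inE eqxx ?orbT.
Qed.

Let segment_coord0 u v k (x : 'rV[R]_#|G|) :
  segment (vertex_pt R u) (vertex_pt R v) x -> k != u -> k != v ->
  x 0 (enum_rank k) = 0.
Proof.
move=> /segmentP[t _ ->] ku kv.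
by rewrite !mxE /= !(inj_eq enum_rank_inj) (negPf ku) (negPf kv) !mulr0 addr0.
Qed.

Let segmentC (n : nat) (a b : 'rV[R]_n) : segment a b `<=` segment b a.
Proof.
move=> x /segmentP[t t01 ->]; apply/segmentP; exists (1 - t); first by lra.
by rewrite subKr addrC.
Qed.

Lemma straight_tame_embedding : tame_embedding emb.
Proof.
split.
- by apply: continuous_subspaceT; exact: mulmx_continuous.
- move=> x y; rewrite !in_setE => -[u [v [_ xs]]] [u' [v' [_ ys]]] xy.
  apply/rowP => i; rewrite -(enum_valK i); set k := enum_val i.
  (* Only the ends of the two segments matter: both points have coordinate zero at every other
     vertex. *)
  have [->|ku] := eqVneq k u; first exact: coord_eq xs ys xy.
  have [->|kv] := eqVneq k v; first exact: coord_eq (segmentC xs) ys xy.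
  have [->|ku'] := eqVneq k u'.
    by apply/esym; apply: coord_eq ys xs _; exact/esym.
  have [->|kv'] := eqVneq k v'.
    by apply/esym; apply: coord_eq (segmentC ys) xs _; exact/esym.
  by rewrite (segment_coord0 xs)// (segment_coord0 ys).
- exists id; first by split; [exact: cont_id|exists id; split => //; exact: cont_id].
  exists [seq (place e.1, place e.2) |
    e <- enum {: G * G} & (e.1 == e.2) || sedge e.1 e.2].
  rewrite image_id; apply/seteqP; split => [_ [x [u [v [uv xs]]] <-]|y].
    exists (place u, place v); last by rewrite /= -emb_segment; exists x.
    apply/mapP; exists (u, v) => //; rewrite mem_filter mem_enum /= andbT.
    by case: uv => ->; rewrite ?eqxx ?orbT.
  move=> [_ /mapP[[u v] + ->]] /=; rewrite mem_filter /= => /andP[uv _].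
  rewrite -emb_segment => -[x xs <-]; exists x => //; exists u, v; split=> //.
  by case/orP: uv => [/eqP|]; [left|right].
Qed.

Let present_lab u v : sedge u v -> present miss (lab u) (lab v).
Proof.
move=> uv; rewrite /present /missing; apply/negP => /orP[] /s_miss /=;
  by rewrite !nth_index// ?uv// sedge_sym uv.
Qed.

Lemma emb_cycle c : uniq c ->
  emb @` cycle_realization R c = polygon (rvert R conf) (cyclic_pairs (map lab c)).
Proof.
move=> uc; have cE : cyclic_pairs (map lab c) =
    [seq (lab u, lab (next c u)) | u <- c].
  rewrite /cyclic_pairs -map_rot -map_next// -map_comp.
  by rewrite (zip_map lab (lab \o next c)).
apply/seteqP; split => [_ [x [u uin xs] <-]|y [e +]].
  exists (lab u, lab (next c u)); first by rewrite cE; apply/mapP; exists u.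
  by have := emb_segment u (next c u); rewrite /place /= => <-; exists x.
rewrite cE => /mapP[u uin ->].
rewrite -[rvert R conf _]/(place u) -[X in segment _ X]/(place (next c u)).
rewrite -emb_segment => -[x xs <-].
by exists x => //; exists u.
Qed.

Lemma straight_not_knotted : ~ intrinsically_knotted R G.
Proof.
move=> /(_ _ straight_tame_embedding)[c [/andP[cc uc] c3]]; apply.
rewrite emb_cycle//; apply: (config_sound _ conf_ok).
- by rewrite map_inj_uniq.
- by apply/allP => _ /mapP[u _ ->]; exact: lab8.
- by rewrite size_map.
- by rewrite cycle_map; apply: (sub_cycle _ cc) => u v; exact: present_lab.
Qed.

End StraightEmbedding.

End StraightGraphs.

(** * Graphs on seven vertices *)

Section Classification.
Local Open Scope nat_scope.

(* K6, K6 with an edge subdivided, the seven-vertex graph obtained from K6 by a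
   triangle-star exchange, and K(3,3,1). *)
Definition linked_graphs : seq (seq (nat * nat)) :=
  [:: [:: (0,1);(0,2);(0,3);(0,4);(0,5);(1,2);(1,3);(1,4);(1,5);(2,3);(2,4);
          (2,5);(3,4);(3,5);(4,5)];
      [:: (0,2);(0,3);(0,4);(0,5);(1,2);(1,3);(1,4);(1,5);(2,3);(2,4);
          (2,5);(3,4);(3,5);(4,5);(0,6);(1,6)];
      [:: (0,1);(0,2);(1,2);(0,3);(0,4);(0,5);(1,3);(1,4);(1,5);(2,3);(2,4);
          (2,5);(3,6);(4,6);(5,6)];
      [:: (0,3);(0,4);(0,5);(1,3);(1,4);(1,5);(2,3);(2,4);(2,5);
          (0,6);(1,6);(2,6);(3,6);(4,6);(5,6)]].

(* One permutation for each copy of the graph inside K7. *)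
Definition canonical k (t : seq nat) : bool :=
  let x i := nth 0 t i in
  match k with
  | 0 => [&& x 0 < x 1, x 1 < x 2, x 2 < x 3, x 3 < x 4 & x 4 < x 5]
  | 1 => [&& x 0 < x 1, x 2 < x 3, x 3 < x 4 & x 4 < x 5]
  | 2 => [&& x 0 < x 1, x 1 < x 2, x 3 < x 4 & x 4 < x 5]
  | _ => [&& x 0 < x 1, x 1 < x 2, x 3 < x 4, x 4 < x 5 & x 0 < x 3]
  end.

Definition copies : seq (nat * seq nat) :=
  flatten [seq [seq (k, t) | t <- permutations (iota 0 7) & canonical k t]
          | k <- iota 0 4].

Definition ordered (p : nat * nat) := if p.1 < p.2 then p else (p.2, p.1).

Definition pairs7 : seq (nat * nat) :=
  [seq p <- [seq (i, j) | i <- iota 0 7, j <- iota 0 7] | p.1 < p.2].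

Definition image_pair (t : seq nat) (p : nat * nat) :=
  ordered (nth 0 t p.1, nth 0 t p.2).

Definition complement_copies : seq (nat * seq nat * seq (nat * nat)) :=
  [seq (kt, [seq image_pair kt.2 p | p <- pairs7
              & p \notin nth [::] linked_graphs kt.1]) | kt <- copies].

Fixpoint lazy_all T (p : pred T) s : bool :=
  if s is x :: s' then (if p x then lazy_all p s' else false) else true.

(* The first test is redundant: it only speeds up the search. *)
Definition found_copy (cs : seq (nat * seq nat * seq (nat * nat))) no : bool :=
  lazy_has (fun c : nat * seq nat * seq (nat * nat) =>
    if lazy_all (fun p => p \in c.2) no then
      all (fun p => image_pair c.1.2 p \notin no) (nth [::] linked_graphs c.1.1)
    else false) cs.

Definition is_path (p q r : nat * nat) : bool :=
  [&& p.2 == q.1, q.2 == r.1 & uniq [:: p.1; p.2; r.1; r.2]].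

Definition swap (p : nat * nat) := (p.2, p.1).

(** Up to reversal of the path, [p] is its first edge, in either direction, or its middle edge. The
    test [c] prunes the inner search. *)
Definition blocked p (no : seq (nat * nat)) : bool :=
  let no' := no ++ map swap no in
  let seek c F := lazy_has (fun q => if c q then lazy_has (F q) no' else false) no' in
  if seek (fun q => p.2 == q.1) (is_path p) then true
  else if seek (fun q => p.1 == q.1) (is_path (swap p)) then true
  else if seek (fun q => q.2 == p.1) (is_path^~ p) then true
  else lazy_has (fun q => lazy_has (fun r =>
    uniq [:: p.1; p.2; q.1; q.2; r.1; r.2]) no) no.

(** Each pair is decided in turn to be an edge or a nonedge, and only nonedges are recorded. A
    nonedge that completes a forbidden pattern closes its branch. *)
Fixpoint search cs (todo no : seq (nat * nat)) : bool :=
  if todo is p :: todo' then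
    if search cs todo' no then
      if blocked p no then true else search cs todo' (p :: no)
    else false
  else found_copy cs no.

Lemma search_ok : search complement_copies pairs7 [::].
Proof. by vm_compute. Qed.

Section SearchSound.
Variable adj : rel nat.
Hypothesis adj_sym : symmetric adj.

Definition obstructed := exists2 miss, miss \in [:: miss1; miss2] &
  exists t, [/\ uniq t, all (gtn 7) t,
    all (fun p => (p.1 < size t) && (p.2 < size t)) miss &
    {in miss, forall p, ~~ adj (nth 0 t p.1) (nth 0 t p.2)}].

Definition contains_linked := exists k t, [/\ k < 4, perm_eq t (iota 0 7) &
  {in nth [::] linked_graphs k, forall p, adj (nth 0 t p.1) (nth 0 t p.2)}].

Definition nonedge (p : nat * nat) := [&& p.1 < 7, p.2 < 7 & ~~ adj p.1 p.2].

Lemma nonedge_swap p : nonedge (swap p) = nonedge p.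
Proof. by rewrite /nonedge /= andbCA adj_sym. Qed.

Lemma path_obstructed p q r : nonedge p -> nonedge q -> nonedge r ->
  is_path p q r -> obstructed.
Proof.
move=> /and3P[p1 p2 pn] /and3P[q1 q2 qn] /and3P[r1 r2 rn].
move=> /and3P[/eqP pq /eqP qr u]; exists miss2; first by rewrite !inE orbT.
exists [:: p.1; p.2; r.1; r.2]; split => //.
  by apply/and5P.
by move=> x; rewrite !inE => /or3P[]/eqP-> //=; rewrite pq -qr.
Qed.

Lemma blocked_obstructed p no : nonedge p -> {in no, forall q, nonedge q} ->
  blocked p no -> obstructed.
Proof.
move=> np nno; have nno' q : q \in no ++ map swap no -> nonedge q.
  rewrite mem_cat => /orP[/nno//|/mapP[q' /nno + ->]].
  by rewrite nonedge_swap.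
have seekP (c : pred (nat * nat)) F s :
    lazy_has (fun q => if c q then lazy_has (F q) s else false) s ->
    exists q r, [/\ q \in s, r \in s & F q r].
  rewrite lazy_hasE => /hasP[q qs]; case: ifP => // _.
  by rewrite lazy_hasE => /hasP[r rs Fqr]; exists q, r.
rewrite /blocked; case: ifP => [/seekP[q [r [/nno' hq /nno' hr]]] + _|_].
  exact: path_obstructed.
case: ifP => [/seekP[q [r [/nno' hq /nno' hr]]] + _|_].
  by apply: path_obstructed; rewrite ?nonedge_swap.
case: ifP => [/seekP[q [r [/nno' hq /nno' hr]]] + _|_].
  exact: path_obstructed.
rewrite lazy_hasE => /hasP[q /nno/and3P[q1 q2 qn]].
rewrite lazy_hasE => /hasP[r /nno/and3P[r1 r2 rn]] u.
case/and3P: np => p1 p2 pn; exists miss1; first by rewrite inE.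
exists [:: p.1; p.2; q.1; q.2; r.1; r.2]; split => //.
  by apply/and5P; split => //; apply/and3P.
by move=> x; rewrite !inE => /or3P[]/eqP->.
Qed.

Lemma copiesP k t : (k, t) \in copies -> k < 4 /\ perm_eq t (iota 0 7).
Proof.
move=> /flatten_mapP[k' k4 /mapP[t' tin [-> ->]]]; split.
  by move: k4; rewrite mem_iota.
by move: tin; rewrite mem_filter mem_permutations => /andP[].
Qed.

Lemma found_copy_sound no : found_copy complement_copies no ->
  (forall p, p \in pairs7 -> (p \in no) || adj p.1 p.2) -> contains_linked.
Proof.
rewrite /found_copy lazy_hasE => /hasP[c /mapP[[k' t'] kt ->]].
have [k4 tperm] := copiesP kt; case: ifP => // _ /allP hno cover.
exists k', t'; split=> // p pE.
have ut : uniq t' by rewrite (perm_uniq tperm) iota_uniq.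
have := hno p pE; rewrite /image_pair.
set i := nth 0 t' p.1; set j := nth 0 t' p.2.
have pE7 : [&& p.1 < 7, p.2 < 7 & p.1 != p.2].
  move: pE; have : all (fun p => [&& p.1 < 7, p.2 < 7 & p.1 != p.2])
    (flatten linked_graphs) by [].
  move=> /allP h pE; apply: h; apply/flattenP; exists (nth [::] linked_graphs k') => //.
  by rewrite mem_nth.
case/and3P: pE7 => p1 p2 p12.
have tsz : size t' = 7 by rewrite (perm_size tperm) size_iota.
have i7 : i < 7.
  have := mem_nth 0 (s := t') (n := p.1).
  by rewrite tsz (perm_mem tperm) mem_iota => /(_ p1).
have j7 : j < 7.
  have := mem_nth 0 (s := t') (n := p.2).
  by rewrite tsz (perm_mem tperm) mem_iota => /(_ p2).
have ij : i != j by rewrite nth_uniq ?tsz.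
have inp a b : a < b -> b < 7 -> (a, b) \in pairs7.
  move=> ab b7; rewrite mem_filter; apply/andP; split=> //.
  apply/allpairsP; exists (a, b); split; rewrite ?mem_iota//.
  exact: ltn_trans ab b7.
rewrite /ordered /=; case: ltngtP ij => // ij _ /negPf nno.
  by have := cover _ (inp _ _ ij j7); rewrite nno.
by have := cover _ (inp _ _ ij i7); rewrite nno /= adj_sym.
Qed.

Lemma search_sound todo no : search complement_copies todo no ->
  {in no, forall p, nonedge p} -> {subset todo <= pairs7} ->
  (forall p, p \in pairs7 -> [|| p \in todo, p \in no | adj p.1 p.2]) ->
  obstructed \/ contains_linked.
Proof.
elim: todo no => [|p todo IH] no /=.
  by move=> ok _ _ cover; right; exact: found_copy_sound ok cover.
case: ifP => // ok1 ok2 nno sub cover.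
have sub' : {subset todo <= pairs7} by move=> q qt; rewrite sub// inE qt orbT.
have [pa|pa] := boolP (adj p.1 p.2).
  apply: IH ok1 nno sub' _ => q /cover; rewrite inE.
  by case/or3P => [/orP[/eqP->|->]|->|->]; rewrite ?pa ?orbT.
have np : nonedge p.
  have := sub p (mem_head _ _); rewrite mem_filter => /andP[_ /allpairsP[[i j]]].
  by rewrite !mem_iota => -[/= i7 j7 pE]; rewrite /nonedge pa pE /= i7 j7.
case: ifP ok2 => [b _|_ ok2]; first by left; exact: blocked_obstructed b.
apply: IH ok2 _ sub' _ => [q|q /cover].
  by rewrite inE => /orP[/eqP->//|/nno].
by rewrite !inE => /or3P[/orP[->|->]|->|->]; rewrite ?orbT.
Qed.

Lemma classification : obstructed \/ contains_linked.
Proof. by apply: search_sound search_ok _ _ _ => // p ->. Qed.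

End SearchSound.

End Classification.

(** * Linking modulo 2 *)

Section Linking.
Local Open Scope classical_set_scope.
Local Open Scope ring_scope.

(* Addition on [bool], the field with two elements, is exclusive or. *)
Lemma bool_addrr (b : bool) : b + b = 0.
Proof. by case: b. Qed.

(** * Crossing parities of short segments *)

Section DiscreteLinking.
Variable R : realType.
Implicit Types a b c d e p q : 'rV[R]_3.

(** The lexicographic order stands for the order of first coordinates after an infinitesimal
    perturbation, so that distinct points always compare. *)
Definition before p q : bool :=
  (xcoord p < xcoord q) || (xcoord p == xcoord q) &&
  ((ycoord p < ycoord q) || (ycoord p == ycoord q) && (zcoord p < zcoord q)).

Lemma before_x p q : xcoord p < xcoord q -> (before p q = 1) * (before q p = 0).
Proof.
by move=> h; rewrite /before h (gt_eqF h) [xcoord q < _]ltNge (ltW h).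
Qed.

Lemma before_total p q :
  [|| xcoord p != xcoord q, ycoord p != ycoord q | zcoord p != zcoord q] ->
  before q p = 1 + before p q.
Proof.
rewrite /before; case: ltgtP => //= _; case: ltgtP => //= _.
by case: ltgtP.
Qed.

(* [c] lies under the segment [ab] in the projection to the [xy]-plane. *)
Definition under a b c : bool := (before a c + before b c) *
  (ycoord c + ycoord c < ycoord a + ycoord b).

(** The correction term in [cross]: when the x-intervals overlap without nesting, the two ends of
    the overlap belong to different segments, and the two [under] tests there compare the segments
    in opposite senses. *)
Definition interleave a b c d : bool :=
  before a c + before a d + before b c + before b d.

(* Mod 2 number of crossings of two segments in the projection to the
   [xy]-plane. The formula makes sense without any general position
   assumption, and it is correct when the segments are in general position and
   short compared to their distance. *)
Definition cross a b c d : bool :=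
  under a b c + under a b d + under c d a + under c d b + interleave a b c d.

Definition over a b c d : bool :=
  cross a b c d * (zcoord c + zcoord d < zcoord a + zcoord b).

Lemma under_rev a b c : under b a c = under a b c.
Proof. by rewrite /under [before b c + _]addrC [ycoord b + _]addrC. Qed.

Lemma cross_revl a b c d : cross b a c d = cross a b c d.
Proof. by rewrite /cross /interleave !(under_rev a b); ring. Qed.

Lemma cross_revr a b c d : cross a b d c = cross a b c d.
Proof. by rewrite /cross /interleave !(under_rev c d); ring. Qed.

Lemma over_revl a b c d : over b a c d = over a b c d.
Proof. by rewrite /over cross_revl [zcoord b + _]addrC. Qed.

Lemma over_revr a b c d : over a b d c = over a b c d.
Proof. by rewrite /over cross_revr [zcoord d + _]addrC. Qed.

Lemma under_cst p c : under p p c = 0.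
Proof. by rewrite /under bool_addrr mul0r. Qed.

Lemma over_cst p c d : over p p c d = 0.
Proof.
rewrite /over /cross !under_cst !add0r bool_addrr add0r /interleave.
by case: (before p c) (before p d) => -[]; rewrite mul0r.
Qed.

Definition apart_in (k : 'rV[R]_3 -> R) (X Y : seq 'rV[R]_3) :=
  (forall p q, p \in X -> q \in Y -> k p < k q) \/
  (forall p q, p \in X -> q \in Y -> k q < k p).

(** Small pieces around two distinct points are separated in this sense, along a coordinate in which
    the points differ. *)
Definition apart X Y :=
  [\/ apart_in (@xcoord R) X Y, apart_in (@ycoord R) X Y
    | apart_in (@zcoord R) X Y].

Lemma sub_apart_in k (X X' Y Y' : seq 'rV[R]_3) :
  {subset X' <= X} -> {subset Y' <= Y} -> apart_in k X Y -> apart_in k X' Y'.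
Proof.
by move=> XX' YY' [] h; [left|right] => p q /XX' ? /YY' ?; exact: h.
Qed.

Lemma sub_apart (X X' Y Y' : seq 'rV[R]_3) :
  {subset X' <= X} -> {subset Y' <= Y} -> apart X Y -> apart X' Y'.
Proof.
move=> XX' YY'; have sub k := @sub_apart_in k _ _ _ _ XX' YY'.
by case=> /sub; [exact: Or31|exact: Or32|exact: Or33].
Qed.

Lemma apart_before p q X Y : apart X Y -> p \in X -> q \in Y ->
  before q p = 1 + before p q.
Proof.
move=> XY pX qY; apply: before_total.
by case: XY => -[] /(_ p q pX qY); case: ltgtP => //; rewrite ?orbT.
Qed.

Lemma cross_x a b c d : apart_in (@xcoord R) [:: a; b] [:: c; d] ->
  cross a b c d = 0.
Proof.
have [ia ib] : a \in [:: a; b] /\ b \in [:: a; b].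
  by split; rewrite !inE eqxx ?orbT.
have [ic id] : c \in [:: c; d] /\ d \in [:: c; d].
  by split; rewrite !inE eqxx ?orbT.
by rewrite /cross /under /interleave => -[] h;
  rewrite !(before_x (h _ _ ia ic), before_x (h _ _ ia id),
    before_x (h _ _ ib ic), before_x (h _ _ ib id)).
Qed.

(** Two of the [under] terms vanish, and the other two add up to [interleave]. *)
Lemma cross_y a b c d : apart_in (@ycoord R) [:: a; b] [:: c; d] ->
  cross a b c d = 0.
Proof.
move=> apy; have ap : apart [:: a; b] [:: c; d] by apply: Or32.
have [ia ib] : a \in [:: a; b] /\ b \in [:: a; b].
  by split; rewrite !inE eqxx ?orbT.
have [ic id] : c \in [:: c; d] /\ d \in [:: c; d].
  by split; rewrite !inE eqxx ?orbT.
rewrite /cross /under /interleave.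
rewrite (apart_before ap ia ic) (apart_before ap ia id).
rewrite (apart_before ap ib ic) (apart_before ap ib id).
move: (before a c) (before a d) (before b c) (before b d) => o1 o2 o3 o4.
case: apy => h; have := h _ _ ia ic; have := h _ _ ia id;
  have := h _ _ ib ic; have := h _ _ ib id => h1 h2 h3 h4.
- have -> : ycoord c + ycoord c < ycoord a + ycoord b = false.
    by apply/negbTE; rewrite -leNgt; lra.
  have -> : ycoord d + ycoord d < ycoord a + ycoord b = false.
    by apply/negbTE; rewrite -leNgt; lra.
  have -> : ycoord a + ycoord a < ycoord c + ycoord d by lra.
  have -> : ycoord b + ycoord b < ycoord c + ycoord d by lra.
  by case: o1 o2 o3 o4 {h1 h2 h3 h4} => -[] [] [].
- have -> : ycoord c + ycoord c < ycoord a + ycoord b by lra.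
  have -> : ycoord d + ycoord d < ycoord a + ycoord b by lra.
  have -> : ycoord a + ycoord a < ycoord c + ycoord d = false.
    by apply/negbTE; rewrite -leNgt; lra.
  have -> : ycoord b + ycoord b < ycoord c + ycoord d = false.
    by apply/negbTE; rewrite -leNgt; lra.
  by case: o1 o2 o3 o4 {h1 h2 h3 h4} => -[] [] [].
Qed.

Lemma crossC a b c d : apart [:: a; b] [:: c; d] -> cross c d a b = cross a b c d.
Proof.
move=> ap; have [ia ib] : a \in [:: a; b] /\ b \in [:: a; b].
  by split; rewrite !inE eqxx ?orbT.
have [ic id] : c \in [:: c; d] /\ d \in [:: c; d].
  by split; rewrite !inE eqxx ?orbT.
rewrite /cross; have -> : interleave c d a b = interleave a b c d.
  rewrite /interleave (apart_before ap ia ic) (apart_before ap ia id).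
  rewrite (apart_before ap ib ic) (apart_before ap ib id).
  by case: (before a c) (before a d) (before b c) (before b d) => -[] [] [].
by ring.
Qed.

(** Separation in x or y makes every term vanish; separation in z makes exactly one segment the
    upper one. *)
Lemma over_cross a b c d : apart [:: a; b] [:: c; d] ->
  over a b c d + over c d a b = cross a b c d.
Proof.
move=> ap; rewrite /over (crossC ap); case: ap => [h|h|h].
- by rewrite cross_x.
- by rewrite cross_y.
rewrite -mulrDr; suff -> : (zcoord c + zcoord d < zcoord a + zcoord b) +
   (zcoord a + zcoord b < zcoord c + zcoord d) = 1 by rewrite mulr1.
have [ia ib] : a \in [:: a; b] /\ b \in [:: a; b].
  by split; rewrite !inE eqxx ?orbT.
have [ic id] : c \in [:: c; d] /\ d \in [:: c; d].
  by split; rewrite !inE eqxx ?orbT.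
case: h => h; have := h _ _ ia ic; have := h _ _ ib id => h1 h2;
  by case: ltgtP => //; lra.
Qed.

(** The corner [p0] stands for the height of the quadrilateral. The sum counts the sides met by a
    vertical ray from [d] in the projection, whose parity tells inside from outside. *)
Definition shadow (p0 p1 p2 p3 d : 'rV[R]_3) : bool :=
  (zcoord d < zcoord p0) *
  (under p0 p1 d + under p1 p2 d + under p2 p3 d + under p3 p0 d).

(* A small quadrilateral away from a segment [de] contributes to linking only
   through the ends of the segment: [shadow] tells whether they lie under it. *)
Lemma over_quad p0 p1 p2 p3 d e : apart [:: p0; p1; p2; p3] [:: d; e] ->
  over p0 p1 d e + over p1 p2 d e + over p2 p3 d e + over p3 p0 d e =
  shadow p0 p1 p2 p3 d + shadow p0 p1 p2 p3 e.
Proof.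
set P := [:: p0; p1; p2; p3] => ap.
have iP : [/\ p0 \in P, p1 \in P, p2 \in P & p3 \in P].
  by rewrite !inE !eqxx !orbT.
have [id ie] : d \in [:: d; e] /\ e \in [:: d; e].
  by split; rewrite !inE eqxx ?orbT.
have [i0 i1 i2 i3] := iP.
have sub x y : x \in P -> y \in P -> {subset [:: x; y] <= P}.
  by move=> xP yP w; rewrite in_cons mem_seq1 => /orP[]/eqP->.
case: ap => h.
- have c0 x y : x \in P -> y \in P -> over x y d e = 0.
    move=> xP yP; rewrite /over cross_x ?mul0r//.
    by apply: sub_apart_in h => //; exact: sub.
  rewrite !c0// /shadow.
  have u0 x y w : x \in P -> y \in P -> w \in [:: d; e] -> under x y w = 0.
    by move=> xP yP wD; rewrite /under; case: h => h;
      rewrite !(before_x (h _ _ xP wD), before_x (h _ _ yP wD)).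
  by rewrite !u0// !addr0 !mulr0.
- have c0 x y : x \in P -> y \in P -> over x y d e = 0.
    move=> xP yP; rewrite /over cross_y ?mul0r//.
    by apply: sub_apart_in h => //; exact: sub.
  rewrite !c0// /shadow.
  suff s0 w : w \in [:: d; e] ->
      under p0 p1 w + under p1 p2 w + under p2 p3 w + under p3 p0 w = 0.
    by rewrite !s0// !mulr0 addr0.
  (* All comparisons of [ycoord] agree, and then each corner occurs twice around the
     quadrilateral. *)
  move=> wD; have [t tE] : exists t : bool, forall x y, x \in P -> y \in P ->
      (ycoord w + ycoord w < ycoord x + ycoord y) = t.
    case: h => h; [exists false|exists true] => x y xP yP;
      have := h _ _ xP wD; have := h _ _ yP wD => h1 h2; last by lra.
    by apply/negbTE; rewrite -leNgt; lra.
  rewrite /under !tE//.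
  by case: (before p0 w) (before p1 w) (before p2 w) (before p3 w) t {tE}
    => -[] [] [] [].
- have [t [tE [tD tD']]] : exists t : bool, (forall x y, x \in P -> y \in P ->
      (zcoord d + zcoord e < zcoord x + zcoord y) = t) /\
      ((zcoord d < zcoord p0) = t /\ (zcoord e < zcoord p0) = t).
    case: h => h.
      exists false; split => [x y xP yP|].
        apply/negbTE; rewrite -leNgt; have := h _ _ xP id; have := h _ _ yP ie; lra.
      by split; apply/negbTE; rewrite -leNgt ltW// h.
    exists true; split => [x y xP yP|]; last by split; apply: h.
    by have := h _ _ xP id; have := h _ _ yP ie; lra.
  rewrite /over /shadow !tE// tD tD' /cross /interleave.
  (* Every corner belongs to two sides, so these terms occur twice. *)
  set X := under d e p0 + under d e p1 + under d e p2 + under d e p3 +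
    (before p0 d + before p1 d + before p2 d + before p3 d) +
    (before p0 e + before p1 e + before p2 e + before p3 e).
  have XX : t * (X + X) = 0 by rewrite bool_addrr mulr0.
  by rewrite -[RHS]addr0 -XX /X; ring.
Qed.

End DiscreteLinking.

Lemma sum_bool_telescope (g : nat -> bool) n :
  \sum_(i < n) (g i + g i.+1) = g 0%N + g n.
Proof.
elim: n => [|n IH]; first by rewrite big_ord0 bool_addrr.
by rewrite big_ord_recr /= IH; case: (g 0%N) (g n) (g n.+1) => -[] [].
Qed.

(** * Crossing parities of sampled paths *)

Section Paths.
Variables (R : realType) (n : nat).
Implicit Types (e f : nat -> 'rV[R]_3) (d : 'rV[R]_3).

Definition path_over e f : bool :=
  \sum_(i < n) \sum_(j < n) over (e i) (e i.+1) (f j) (f j.+1).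

Definition path_under e d : bool := \sum_(i < n) under (e i) (e i.+1) d.

(** The [under] terms telescope along the path of the tested points and [interleave] along both
    paths, so only the ends survive. *)
Lemma path_over_cross e f :
  (forall i j, (i < n)%N -> (j < n)%N ->
     apart [:: e i; e i.+1] [:: f j; f j.+1]) ->
  path_over e f + path_over f e =
  path_under e (f 0%N) + path_under e (f n) +
  (path_under f (e 0%N) + path_under f (e n)) +
  interleave (e 0%N) (e n) (f 0%N) (f n).
Proof.
move=> ap; rewrite /path_over [X in _ + X]exchange_big -big_split /=.
pose u i j := under (e i) (e i.+1) (f j).
pose v j i := under (f j) (f j.+1) (e i).
pose w i j := before (e i) (f j) + before (e i.+1) (f j).
transitivity (\sum_(i < n) \sum_(j < n) (u i j + u i j.+1) +
    \sum_(i < n) \sum_(j < n) (v j i + v j i.+1) +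
    \sum_(i < n) \sum_(j < n) (w i j + w i j.+1)).
  rewrite -!big_split; apply: eq_bigr => i _; rewrite -!big_split.
  apply: eq_bigr => j _; rewrite [LHS]over_cross; last exact: ap.
  by rewrite /u /v /w /cross /interleave /=; ring.
have -> : \sum_(i < n) \sum_(j < n) (u i j + u i j.+1) =
    path_under e (f 0%N) + path_under e (f n).
  by rewrite -big_split; apply: eq_bigr => i _; rewrite (sum_bool_telescope (u i)).
have -> : \sum_(i < n) \sum_(j < n) (v j i + v j i.+1) =
    path_under f (e 0%N) + path_under f (e n).
  rewrite exchange_big -big_split; apply: eq_bigr => j _.
  by rewrite (sum_bool_telescope (v j)).
congr (_ + _); under eq_bigr do rewrite (sum_bool_telescope (w _)).
rewrite big_split /= /w (sum_bool_telescope (fun i => before (e i) (f 0%N))).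
rewrite (sum_bool_telescope (fun i => before (e i) (f n))) /interleave.
by ring.
Qed.

Lemma path_over_rev e e' f : (forall i, (i <= n)%N -> e' i = e (n - i)%N) ->
  path_over e' f = path_over e f.
Proof.
move=> e'E; rewrite /path_over (reindex_inj rev_ord_inj) /=.
apply: eq_bigr => i _; apply: eq_bigr => j _.
by rewrite subnSK// !e'E ?leq_subr// !subKn ?(ltnW (ltn_ord i))// over_revl.
Qed.

Lemma path_over_revr e f f' : (forall i, (i <= n)%N -> f' i = f (n - i)%N) ->
  path_over e f' = path_over e f.
Proof.
move=> f'E; rewrite /path_over; apply: eq_bigr => i _.
rewrite (reindex_inj rev_ord_inj) /=; apply: eq_bigr => j _.
by rewrite subnSK// !f'E ?leq_subr// !subKn ?(ltnW (ltn_ord j))// over_revr.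
Qed.

Lemma path_over_cst e f p : (forall i, (i <= n)%N -> e i = p) ->
  path_over e f = 0.
Proof.
move=> ep; rewrite /path_over big1// => i _; rewrite big1// => j _.
by rewrite !ep ?over_cst// ltnW.
Qed.

Definition strip_shadow (F : nat -> nat -> 'rV[R]_3) (d : 'rV[R]_3) : bool :=
  \sum_(k < n) \sum_(i < n)
    shadow (F k i) (F k i.+1) (F k.+1 i.+1) (F k.+1 i) d.

(** A discrete Stokes formula: when [over_quad] is summed over the grid, inner sides cancel and the
    shadows telescope along [f]. *)
Lemma path_over_strip (F : nat -> nat -> 'rV[R]_3) f :
  (forall k i j, (k < n)%N -> (i < n)%N -> (j < n)%N ->
     apart [:: F k i; F k i.+1; F k.+1 i.+1; F k.+1 i] [:: f j; f j.+1]) ->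
  path_over (F 0%N) f + path_over (F n) f +
  (path_over (F^~ 0%N) f + path_over (F^~ n) f) =
  strip_shadow F (f 0%N) + strip_shadow F (f n).
Proof.
move=> ap; pose h k i j := over (F k i) (F k i.+1) (f j) (f j.+1).
pose v i k j := over (F k i) (F k.+1 i) (f j) (f j.+1).
pose s k i d := shadow (F k i) (F k i.+1) (F k.+1 i.+1) (F k.+1 i) d.
transitivity (\sum_(k < n) \sum_(i < n) \sum_(j < n)
    (s k i (f j) + s k i (f j.+1))); last first.
  rewrite -big_split; apply: eq_bigr => k _; rewrite -big_split.
  by apply: eq_bigr => i _; rewrite (sum_bool_telescope (fun j => s k i (f j))).
transitivity (\sum_(k < n) \sum_(i < n) \sum_(j < n)
    ((h k i j + h k.+1 i j) + (v i k j + v i.+1 k j))); last first.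
  apply: eq_bigr => k _; apply: eq_bigr => i _; apply: eq_bigr => j _.
  rewrite -[RHS]over_quad; last exact: ap.
  rewrite (over_revl (F k.+1 i)) (over_revl (F k i)) /h /v.
  by ring.
transitivity (\sum_(k < n) (\sum_(i < n) \sum_(j < n) h k i j +
      \sum_(i < n) \sum_(j < n) h k.+1 i j) +
    \sum_(i < n) (\sum_(k < n) \sum_(j < n) v i k j +
      \sum_(k < n) \sum_(j < n) v i.+1 k j)).
  rewrite (sum_bool_telescope (fun k => \sum_(i < n) \sum_(j < n) h k i j)).
  by rewrite (sum_bool_telescope (fun i => \sum_(k < n) \sum_(j < n) v i k j)).
rewrite !big_split /= [X in _ + (X + _)]exchange_big.
rewrite [X in _ + (_ + X)]exchange_big /= -!big_split.
apply: eq_bigr => k _; rewrite -!big_split; apply: eq_bigr => i _.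
by rewrite -!big_split.
Qed.

End Paths.

Lemma sum_bool_next (T : eqType) (c : seq T) (g : T -> bool) : uniq c ->
  \sum_(u <- c) (g u + g (next c u)) = 0.
Proof.
move=> uc; rewrite big_split /=.
have -> : \sum_(u <- c) g (next c u) = \sum_(u <- c) g u; last exact: bool_addrr.
rewrite -(big_map (next c) xpredT g) map_next//.
by apply: perm_big; exact: permEl (perm_rot 1 c).
Qed.

Section CycleLinking.
Variables (R : realType) (n : nat) (T : eqType) (p : T -> 'rV[R]_3).
Variable E : T -> T -> nat -> 'rV[R]_3.
Hypothesis E0 : forall u v, E u v 0 = p u.
Hypothesis En : forall u v, E u v n = p v.

(** The linking number mod 2, as the parity of the crossings where the first curve is on top. *)
Definition cycle_linking (c d : seq T) : bool :=
  \sum_(u <- c) \sum_(v <- d)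
    path_over n (E u (next c u)) (E v (next d v)).

(* The grids [F u] form a discrete homotopy which contracts the first cycle to
   the point [q] away from the second one. *)
Lemma contractible_cycle_linking (c d : seq T) (F : T -> nat -> nat -> 'rV[R]_3)
    (H : nat -> T -> 'rV[R]_3) (q : 'rV[R]_3) :
  uniq c -> uniq d ->
  (forall u i, u \in c -> (i <= n)%N -> F u 0 i = E u (next c u) i) ->
  (forall u i, u \in c -> (i <= n)%N -> F u n i = q) ->
  (forall u k, u \in c -> (k <= n)%N -> F u k 0 = H k u) ->
  (forall u k, u \in c -> (k <= n)%N -> F u k n = H k (next c u)) ->
  (forall u v k i j, u \in c -> v \in d ->
     (k < n)%N -> (i < n)%N -> (j < n)%N ->
     apart [:: F u k i; F u k i.+1; F u k.+1 i.+1; F u k.+1 i]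
       [:: E v (next d v) j; E v (next d v) j.+1]) ->
  cycle_linking c d = 0.
Proof.
move=> uc ud F0 Fn FH FH' ap.
have eqo (e e' f : nat -> 'rV[R]_3) : (forall i, (i <= n)%N -> e i = e' i) ->
    path_over n e f = path_over n e' f.
  move=> ee'; apply: eq_bigr => i _; apply: eq_bigr => j _.
  by rewrite !ee'// ltnW.
pose f v := E v (next d v).
pose V w v := path_over n (H^~ w) (f v).
have strip u v : u \in c -> v \in d ->
    path_over n (E u (next c u)) (f v) + (V u v + V (next c u) v) =
    strip_shadow n (F u) (p v) + strip_shadow n (F u) (p (next d v)).
  move=> uin vin; rewrite -(E0 v (next d v)) -(En v (next d v)).
  rewrite -path_over_strip; last by move=> *; exact: ap.
  rewrite [X in _ = _ + X + _](path_over_cst _ (fun i => Fn u i uin)) addr0.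
  congr (_ + _); first by apply: eqo => i ni; rewrite F0.
  by congr (_ + _); apply: eqo => k nk; rewrite (FH, FH').
transitivity (\sum_(u <- c) \sum_(v <- d)
    (strip_shadow n (F u) (p v) + strip_shadow n (F u) (p (next d v)))).
  (* Consecutive strips share a side, since both are traced by [H], so the sides cancel around
     [c]. *)
  transitivity (\sum_(u <- c) \sum_(v <- d) path_over n (E u (next c u)) (f v) +
      \sum_(v <- d) \sum_(u <- c) (V u v + V (next c u) v)).
    rewrite [X in _ = _ + X]big1 ?addr0// => v _.
    exact: (sum_bool_next (V^~ v)).
  rewrite [X in _ + X]exchange_big -big_split big_seq [RHS]big_seq.
  apply: eq_bigr => u uin; rewrite -big_split big_seq [RHS]big_seq.
  by apply: eq_bigr => v vin; exact: strip.
(* The shadows of the vertices of [d] cancel around [d]. *)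
rewrite big1// => u _; exact: (sum_bool_next (fun v => strip_shadow n (F u) (p v))).
Qed.

End CycleLinking.

(** * Parity certificates for the four graphs *)

Section Certificate.
Local Open Scope nat_scope.

(* For each graph, pairs of disjoint cycles whose linking numbers have an odd
   sum in every embedding. The order inside each pair matters: it is chosen so
   that an edge [e] of a first cycle and an edge [f] of the second one occur
   together as often, mod 2, as [f] in a first cycle and [e] in the second one,
   because only the sum [over e f + over f e] is understood. *)
Definition certificates : seq (seq (seq nat * seq nat)) :=
  [:: [:: ([:: 2; 3; 5], [:: 0; 1; 4]); ([:: 2; 4; 5], [:: 0; 1; 3]);
          ([:: 3; 4; 5], [:: 0; 1; 2]); ([:: 1; 3; 5], [:: 0; 2; 4]);
          ([:: 1; 4; 5], [:: 0; 2; 3]); ([:: 2; 3; 4], [:: 0; 1; 5]);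
          ([:: 1; 2; 5], [:: 0; 3; 4]); ([:: 1; 3; 4], [:: 0; 2; 5]);
          ([:: 1; 2; 4], [:: 0; 3; 5]); ([:: 1; 2; 3], [:: 0; 4; 5])];
      [:: ([:: 1; 3; 5], [:: 0; 2; 4]); ([:: 1; 4; 5], [:: 0; 2; 3]);
          ([:: 0; 2; 1; 6], [:: 3; 4; 5]); ([:: 1; 2; 5], [:: 0; 3; 4]);
          ([:: 1; 3; 4], [:: 0; 2; 5]); ([:: 0; 3; 1; 6], [:: 2; 4; 5]);
          ([:: 1; 2; 4], [:: 0; 3; 5]); ([:: 0; 4; 1; 6], [:: 2; 3; 5]);
          ([:: 0; 5; 1; 6], [:: 2; 3; 4]); ([:: 1; 2; 3], [:: 0; 4; 5])];
      [:: ([:: 2; 3; 6; 5], [:: 0; 1; 4]); ([:: 2; 4; 6; 5], [:: 0; 1; 3]);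
          ([:: 1; 3; 6; 5], [:: 0; 2; 4]); ([:: 1; 4; 6; 5], [:: 0; 2; 3]);
          ([:: 0; 3; 6; 5], [:: 1; 2; 4]); ([:: 0; 4; 6; 5], [:: 1; 2; 3]);
          ([:: 1; 3; 6; 4], [:: 0; 2; 5]); ([:: 2; 3; 6; 4], [:: 0; 1; 5]);
          ([:: 0; 3; 6; 4], [:: 1; 2; 5])];
      [:: ([:: 1; 4; 2; 5], [:: 0; 3; 6]); ([:: 0; 3; 2; 5], [:: 1; 4; 6]);
          ([:: 0; 3; 2; 4], [:: 1; 5; 6]); ([:: 0; 3; 1; 5], [:: 2; 4; 6]);
          ([:: 1; 3; 2; 5], [:: 0; 4; 6]); ([:: 0; 4; 2; 5], [:: 1; 3; 6]);
          ([:: 0; 4; 1; 5], [:: 2; 3; 6]); ([:: 1; 3; 2; 4], [:: 0; 5; 6]);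
          ([:: 0; 3; 1; 4], [:: 2; 5; 6])]].

(** The unknown bits are encoded as tagged lists, so that cancellation mod 2 is decided by counting
    occurrences. *)
Definition over_var (e f : nat * nat) : seq nat := [:: 0; e.1; e.2; f.1; f.2].
Definition under_var (e : nat * nat) w : seq nat := [:: 1; e.1; e.2; w].
Definition before_var u v : seq nat := [:: 2; u; v].

Definition linking_vars (cd : seq nat * seq nat) : seq (seq nat) :=
  [seq over_var (ordered e) (ordered f) | e <- cyclic_pairs cd.1,
                                          f <- cyclic_pairs cd.2].

(** Ten bits whose sum is 0 by [path_over_cross]; those in [order_vars] have sum 1. *)
Definition crossing_vars (ef : (nat * nat) * (nat * nat)) : seq (seq nat) :=
  let e := ef.1 in let f := ef.2 in
  [:: over_var e f; over_var f e; under_var e f.1; under_var e f.2;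
      under_var f e.1; under_var f e.2; before_var e.1 f.1; before_var e.1 f.2;
      before_var e.2 f.1; before_var e.2 f.2].

Definition order_vars (uv : nat * nat) : seq (seq nat) :=
  [:: before_var uv.1 uv.2; before_var uv.2 uv.1].

(** The comparison of indices takes each unordered pair of edges once. *)
Definition crossing_pairs k : seq ((nat * nat) * (nat * nat)) :=
  let E := nth [::] linked_graphs k in
  let s := flatten (map linking_vars (nth [::] certificates k)) in
  [seq ef <- [seq (e, f) | e <- E, f <- E]
    | [&& index ef.1 E < index ef.2 E, uniq [:: ef.1.1; ef.1.2; ef.2.1; ef.2.2]
        & odd (count_mem (over_var ef.1 ef.2) s)]].

Definition order_pairs k : seq (nat * nat) :=
  let s := flatten (map crossing_vars (crossing_pairs k)) in
  [seq uv <- pairs7 | odd (count_mem (before_var uv.1 uv.2) s)].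

Definition all_vars k : seq (seq nat) :=
  flatten (map linking_vars (nth [::] certificates k)) ++
  flatten (map crossing_vars (crossing_pairs k)) ++
  flatten (map order_vars (order_pairs k)).

Definition cancels (s : seq (seq nat)) : bool :=
  all (fun x => ~~ odd (count_mem x s)) (undup s).

(** Every bit occurs evenly often, so the total is 0. If all the linking numbers vanished, the
    linking and crossing relations would add up to 0 and the oddly many order relations to 1. *)
Definition certified k : bool :=
  cancels (all_vars k) && odd (size (order_pairs k)).

Lemma certificates_ok : all certified (iota 0 4).
Proof. by vm_compute. Qed.

End Certificate.

Lemma mulrn_bool (b : bool) n : b *+ n = b * odd n.
Proof.
elim: n => [|n IH]; first by rewrite mulr0n mulr0.
by rewrite mulrS IH /= {IH}; case: b (odd n) => -[].
Qed.

Lemma sum_bool_cancels (val : seq nat -> bool) s :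
  cancels s -> \sum_(x <- s) val x = 0.
Proof.
move=> /allP cs; rewrite -big_undup_iterop_count big1_seq//= => x /cs even_x.
transitivity (val x *+ count_mem x s); first by [].
by rewrite mulrn_bool (negPf even_x) mulr0.
Qed.

Section CertificateSound.
Variables (k : nat) (ov : nat -> nat -> nat -> nat -> bool).
Variables (un : nat -> nat -> nat -> bool) (bf : nat -> nat -> bool).
Hypothesis k4 : (k < 4)%N.

Let E := nth [::] linked_graphs k.

Hypothesis ov_revl : forall a b c d, ov b a c d = ov a b c d.
Hypothesis ov_revr : forall a b c d, ov a b d c = ov a b c d.
Hypothesis ov_cross : forall e f, e \in E -> f \in E ->
  uniq [:: e.1; e.2; f.1; f.2] ->
  ov e.1 e.2 f.1 f.2 + ov f.1 f.2 e.1 e.2 =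
  un e.1 e.2 f.1 + un e.1 e.2 f.2 + (un f.1 f.2 e.1 + un f.1 f.2 e.2) +
  (bf e.1 f.1 + bf e.1 f.2 + bf e.2 f.1 + bf e.2 f.2).
Hypothesis bf_total : forall u v, (u < v < 7)%N -> bf v u = 1 + bf u v.
Hypothesis unlinked : forall cd, cd \in nth [::] certificates k ->
  \sum_(u <- cd.1) \sum_(v <- cd.2) ov u (next cd.1 u) v (next cd.2 v) = 0.

Let val (x : seq nat) : bool :=
  match x with
  | [:: 0; a; b; c; d] => ov a b c d
  | [:: 1; a; b; w] => un a b w
  | [:: 2; u; v] => bf u v
  | _ => false
  end%N.

Lemma linking_vars_sum cd : uniq cd.1 -> uniq cd.2 ->
  \sum_(x <- linking_vars cd) val x =
  \sum_(u <- cd.1) \sum_(v <- cd.2) ov u (next cd.1 u) v (next cd.2 v).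
Proof.
move=> u1 u2; rewrite /linking_vars big_allpairs_dep /cyclic_pairs -!map_next//.
have zipE (c : seq nat) : zip c (map (next c) c) = [seq (u, next c u) | u <- c].
  by rewrite -{1}(map_id c) zip_map.
rewrite !zipE big_map; apply: eq_bigr => u _; rewrite big_map.
apply: eq_bigr => v _; rewrite /ordered /=.
by case: ifP => _; case: ifP => _ /=;
  rewrite ?(ov_revl (next cd.1 u) u) ?(ov_revr _ _ (next cd.2 v) v).
Qed.

Lemma certificate_sound : False.
Proof.
have /andP[c_ok odd_ok] := allP certificates_ok k (etrans (mem_iota 0 4 k) k4).
have := sum_bool_cancels val c_ok; rewrite /all_vars !big_cat /=.
rewrite [X in X + _]big_flatten big_map big1_seq ?add0r; last first.
  move=> cd /= cdin; rewrite linking_vars_sum ?unlinked//.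
    have : all (fun cd => uniq cd.1) (flatten certificates) by [].
    move/allP; apply; apply/flattenP.
    by exists (nth [::] certificates k); rewrite ?mem_nth.
  have : all (fun cd => uniq cd.2) (flatten certificates) by [].
  move/allP; apply; apply/flattenP.
  by exists (nth [::] certificates k); rewrite ?mem_nth.
rewrite [X in X + _]big_flatten big_map big1_seq ?add0r; last first.
  move=> ef /=; rewrite mem_filter => /andP[/and3P[_ ef_uniq _]].
  move=> /allpairsP[[e f] /= [eE fE efE]]; rewrite efE /= in ef_uniq *.
  rewrite !big_cons big_nil /= addr0.
  have := ov_cross eE fE ef_uniq; rewrite addrA => ->.
  set u := un _ _ _ + _ + _; set b := _ + _ + _ + bf _ _.
  by rewrite -[RHS](bool_addrr (u + b)) /u /b; ring.
rewrite big_flatten big_map.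
have total uv : uv \in order_pairs k -> \sum_(x <- order_vars uv) val x = 1.
  rewrite mem_filter => /andP[_]; rewrite mem_filter => /andP[uv1].
  move=> /allpairsP[[i j] [_ + uvE]]; rewrite mem_iota => /= j7.
  rewrite /order_vars !big_cons big_nil /= addr0 (@bf_total uv.1 uv.2); last first.
    by move: uv1; rewrite uvE /= => ->.
  by rewrite addrCA bool_addrr addr0.
rewrite (eq_big_seq (fun=> 1 : bool)) /=; last exact: total.
by rewrite big_const_seq count_predT iter_addr_0 mulrn_bool odd_ok.
Qed.

End CertificateSound.

End Linking.

(** * Intrinsically linked graphs *)

Section Intrinsic.
Local Open Scope classical_set_scope.
Local Open Scope ring_scope.

(** * Separation of fine samplings *)

Section Sampling.
Variables (R : realType) (Phi : R * R -> 'rV[R]_3) (Psi : R -> 'rV[R]_3).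
Hypothesis Phi_cont : continuous Phi.
Hypothesis Psi_cont : continuous Psi.
Hypothesis disj : forall s t t', 0 <= s <= 1 -> 0 <= t <= 1 -> 0 <= t' <= 1 ->
  Phi (s, t) <> Psi t'.

Let box (n : nat) (w w' : R * R * R) :=
  [/\ `|w.1.1 - w'.1.1| <= n.+1%:R^-1, `|w.1.2 - w'.1.2| <= n.+1%:R^-1
    & `|w.2 - w'.2| <= n.+1%:R^-1].

Let gap (k : 'rV[R]_3 -> R) (w : R * R * R) := k (Psi w.2) - k (Phi w.1).

Let box_apart n w (k : 'rV[R]_3 -> R) :=
  (forall w1 w2, box n w w1 -> box n w w2 -> k (Phi w1.1) < k (Psi w2.2)) \/
  (forall w1 w2, box n w w1 -> box n w w2 -> k (Psi w2.2) < k (Phi w1.1)).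

(** The bound is uniform in [w'] near [w], which is the form that compactness of the parameter cube
    takes as input. *)
Let locally_apart w k : continuous k -> gap k w != 0 ->
  \forall w' \near w & n \near \oo, box_apart n w' k.
Proof.
move=> kc gap0.
have gc : continuous (gap k).
  apply: cont_add => [x|].
    apply: continuous_comp; last exact: kc.
    by apply: continuous_comp; [exact: cvg_snd|exact: Psi_cont].
  apply: cont_opp => x; apply: continuous_comp; last exact: kc.
  by apply: continuous_comp; [exact: cvg_fst|exact: Phi_cont].
have [e e0 he] : exists2 e : R, 0 < e & 
    (forall w', ball w e w' -> 0 < gap k w') \/
    (forall w', ball w e w' -> gap k w' < 0).
  have [gp|gn] := ltP 0 (gap k w).
    have gp' : nbhs w [set w' | 0 < gap k w'] .
      by apply: (cvgr_gt (gap k w) (gc w)).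
    have [e /= e0 he] := (nbhs_ballP _ _).1 gp'.
    by exists e => //; left.
  have gn' : gap k w < 0 by rewrite lt_neqAle gap0.
  have gn2 : nbhs w [set w' | gap k w' < 0] .
    by apply: (cvgr_lt (gap k w) (gc w)).
  have [e /= e0 he] := (nbhs_ballP _ _).1 gn2.
  by exists e => //; right.
have e2 : 0 < e / 2 by rewrite divr_gt0.
(* Half of the radius is spent on the distance from [w] to [w'], half on the size of the box. *)
exists (ball w (e / 2), [set n | n.+1%:R^-1 < e / 2]).
  split; first exact: nbhsx_ballx.
  exact: (near_infty_natSinv_lt (PosNum e2)).
case=> w' n [/= [[b1 b2] b3] hn].
have tri (r x y z : R) : r < e / 2 -> `|x - y| < e / 2 -> `|y - z| <= r ->
    `|x - z| < e.
  by move=> re xy yz; have := ler_distD y x z; lra.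
have sub w1 w2 : box n w' w1 -> box n w' w2 -> ball w e (w1.1, w2.2).
  move=> [h1 h2 _] [_ _ h3]; split; first split.
  - by apply: (tri _ _ _ _ hn b1 h1).
  - by apply: (tri _ _ _ _ hn b2 h2).
  - by apply: (tri _ _ _ _ hn b3 h3).
case: he => he; [left|right] => w1 w2 h1 h2; have := he _ (sub _ _ h1 h2);
  by rewrite /gap /= ?subr_gt0 ?subr_lt0.
Qed.

Let grid n i : R := i%:R / n.+1%:R.

(** A Lebesgue number argument on the cube of parameters: distinct points differ in some coordinate,
    which still separates small boxes around them. *)
Lemma eventually_apart : \forall n \near \oo, forall k i j,
  (k < n.+1)%N -> (i < n.+1)%N -> (j < n.+1)%N ->
  apart [:: Phi (grid n k, grid n i); Phi (grid n k, grid n i.+1);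
            Phi (grid n k.+1, grid n i.+1); Phi (grid n k.+1, grid n i)]
        [:: Psi (grid n j); Psi (grid n j.+1)].
Proof.
pose K : set (R * R * R) := `[0, 1] `*` `[0, 1] `*` `[0, 1].
have Kc : compact K.
  by apply: compact_setX; [apply: compact_setX|]; exact: segment_compact.
pose P n w := [\/ box_apart n w (@xcoord R), box_apart n w (@ycoord R)
  | box_apart n w (@zcoord R)].
have : \forall n \near \oo, K `<=` P n.
  apply: ((compact_near_coveringP K).1 Kc) => -[[s t] t'] [[/= s01 t01] t'01].
  move: s01 t01 t'01; rewrite !in_itv /= => s01 t01 t'01.
  have D := disj s01 t01 t'01.
  have [x0|x0] := eqVneq (gap (@xcoord R) (s, t, t')) 0; last first.
    have := locally_apart (@xcoord_continuous R) x0.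
    by apply: filterS => w; exact: Or31.
  have [y0|y0] := eqVneq (gap (@ycoord R) (s, t, t')) 0; last first.
    have := locally_apart (@ycoord_continuous R) y0.
    by apply: filterS => w; exact: Or32.
  have [z0|z0] := eqVneq (gap (@zcoord R) (s, t, t')) 0; last first.
    have := locally_apart (@zcoord_continuous R) z0.
    by apply: filterS => w; exact: Or33.
  by case: D; apply/esym/pt_eq; apply/subr0_eq.
apply: filterS => n hn k i j kn iN jn.
have g01 m : (m < n.+1)%N -> 0 <= grid n m <= 1.
  move=> mn; rewrite /grid divr_ge0//= ler_pdivrMr// mul1r ler_nat ltnW//.
have near_grid m : `|grid n m - grid n m.+1| <= n.+1%:R^-1.
  rewrite distrC /grid -mulrBl -natrB// subSnn mul1r ger0_norm//.
have near_id (x : R) : `|x - x| <= n.+1%:R^-1 by rewrite subrr normr0 invr_ge0.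
have /hn : K (grid n k, grid n i, grid n j).
  by split; [split|]; rewrite /= in_itv /=; apply: g01.
pose w a b c : R * R * R := (grid n a, grid n b, grid n c).
have wE a b c : a \in [:: k; k.+1] -> b \in [:: i; i.+1] -> c \in [:: j; j.+1] ->
    box n (w k i j) (w a b c).
  by rewrite !inE => /orP[]/eqP-> /orP[]/eqP-> /orP[]/eqP->; split => /=;
    do ?[exact: near_id|exact: near_grid].
have apart_of c : box_apart n (w k i j) c -> apart_in c
    [:: Phi (grid n k, grid n i); Phi (grid n k, grid n i.+1);
            Phi (grid n k.+1, grid n i.+1); Phi (grid n k.+1, grid n i)]
        [:: Psi (grid n j); Psi (grid n j.+1)].
  have lift (Q : 'rV[R]_3 -> 'rV[R]_3 -> Prop) :
      (forall w1 w2, box n (w k i j) w1 -> box n (w k i j) w2 ->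
         Q (Phi w1.1) (Psi w2.2)) ->
      forall p q, p \in [:: Phi (grid n k, grid n i); Phi (grid n k, grid n i.+1);
            Phi (grid n k.+1, grid n i.+1); Phi (grid n k.+1, grid n i)] ->
        q \in [:: Psi (grid n j); Psi (grid n j.+1)] -> Q p q.
    move=> hQ p q pin qin.
    have [a [b [ak bi ->]]] : exists a b,
        [/\ a \in [:: k; k.+1], b \in [:: i; i.+1] & p = Phi (grid n a, grid n b)].
      move: pin; rewrite !inE => /or4P[]/eqP->;
        by [exists k, i; rewrite !inE !eqxx|exists k, i.+1; rewrite !inE !eqxx ?orbT
           |exists k.+1, i.+1; rewrite !inE !eqxx ?orbT
           |exists k.+1, i; rewrite !inE !eqxx ?orbT].
    have [c' cj ->] : exists2 c', c' \in [:: j; j.+1] & q = Psi (grid n c').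
      move: qin; rewrite !inE => /orP[]/eqP->;
        by [exists j; rewrite ?inE ?eqxx|exists j.+1; rewrite ?inE ?eqxx ?orbT].
    apply: (hQ (w a b j) (w k i c')); apply: wE => //; exact: mem_head.
  by case=> h; [left; apply: (lift (fun p q => c p < c q))
    |right; apply: (lift (fun p q => c q < c p))].
by case=> /apart_of; [exact: Or31|exact: Or32|exact: Or33].
Qed.

End Sampling.

Lemma continuous_within_comp (S T U : topologicalType) (A : set T)
    (f : T -> U) (g : S -> T) :
  {within A, continuous f} -> continuous g -> (forall x, A (g x)) ->
  continuous (f \o g).
Proof.
move=> fc gc gA x; have := fc (g x).
rewrite /continuous_at => fgx; apply: cvg_trans fgx.
move=> B; rewrite /= /nbhs /= -nbhs_subspace_in// => hB.
have h2 : nbhs x (g @^-1` [set y | A y -> B (f y)]) := gc x _ hB.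
by apply: filterS h2 => y; apply; exact: gA.
Qed.

Lemma eventually_all (T : eqType) (s : seq T) (P : T -> nat -> Prop) :
  {in s, forall x, \forall n \near \oo, P x n} ->
  \forall n \near \oo, {in s, forall x, P x n}.
Proof.
elim: s => [|y s IH] h; first by apply: nearW.
have hy := h y (mem_head _ _).
have hs : \forall n \near \oo, {in s, forall x, P x n}.
  by apply: IH => x xs; apply: h; rewrite inE xs orbT.
by apply: filterS2 hy hs => n ny ns x; rewrite inE => /orP[/eqP->//|/ns].
Qed.

Section Clamp.
Variable R : realType.

(** Paths on the unit interval are extended by constants, so that they are continuous on the whole
    line. *)
Definition clamp (t : R) : R := Num.max 0 (Num.min 1 t).

Lemma clamp01 t : 0 <= clamp t <= 1.
Proof. by rewrite /clamp le_max lexx ge_max ler01 ge_min lexx. Qed.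

Lemma clamp_id t : 0 <= t <= 1 -> clamp t = t.
Proof. by move=> /andP[t0 t1]; rewrite /clamp min_r// max_r. Qed.

Lemma clamp_continuous : continuous clamp.
Proof.
apply: cont_max; first exact: cst_continuous.
by apply: cont_min; [exact: cst_continuous|exact: cont_id].
Qed.

End Clamp.

Section EdgePaths.
Variables (R : realType) (G : sgraph) (f : 'rV[R]_#|G| -> 'rV[R]_3).
Hypothesis f_cont : {within realization R G, continuous f}.
Hypothesis f_inj : {in realization R G &, injective f}.

Definition edge_pt (u v : G) (t : R) : 'rV[R]_#|G| :=
  (1 - clamp t) *: vertex_pt R u + clamp t *: vertex_pt R v.

Definition edge_path u v t := f (edge_pt u v t).

Lemma segment_edge_pt u v t : segment (vertex_pt R u) (vertex_pt R v) (edge_pt u v t).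
Proof. by apply/segmentP; exists (clamp t) => //; exact: clamp01. Qed.

Lemma realization_edge_pt u v t : sedge u v -> realization R G (edge_pt u v t).
Proof. by move=> uv; exists u, v; split; [right|exact: segment_edge_pt]. Qed.

Lemma edge_path_continuous u v : sedge u v -> continuous (edge_path u v).
Proof.
move=> uv; have gc : continuous (edge_pt u v).
  apply: cont_add; apply: cont_scale; try exact: cst_continuous.
    apply: cont_add; first exact: cst_continuous.
    by apply: cont_opp; exact: clamp_continuous.
  exact: clamp_continuous.
exact: (continuous_within_comp f_cont gc (fun t => realization_edge_pt t uv)).
Qed.

Definition sample n u v i : 'rV[R]_3 := edge_path u v (i%:R / n.+1%:R).

Lemma sample0 n u v : sample n u v 0 = f (vertex_pt R u).
Proof.
by rewrite /sample /edge_path /edge_pt mul0r clamp_id ?lexx ?ler01//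
  subr0 scale1r scale0r addr0.
Qed.

Lemma sample_last n u v : sample n u v n.+1 = f (vertex_pt R v).
Proof.
by rewrite /sample /edge_path /edge_pt divff ?pnatr_eq0// clamp_id ?lexx ?ler01//
  subrr scale1r scale0r add0r.
Qed.

Let grid01 n i : (i <= n.+1)%N -> 0 <= (i%:R / n.+1%:R : R) <= 1.
Proof. by move=> ni; rewrite divr_ge0//= ler_pdivrMr// mul1r ler_nat. Qed.

Lemma sample_rev n u v i : (i <= n.+1)%N -> sample n v u i = sample n u v (n.+1 - i)%N.
Proof.
move=> ni; rewrite /sample /edge_path /edge_pt !clamp_id ?grid01 ?leq_subr//.
rewrite natrB// mulrBl divff ?pnatr_eq0// subKr addrC //.
Qed.

Lemma vertex_coord (u k : G) : vertex_pt R u 0 (enum_rank k) = (k == u)%:R.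
Proof. by rewrite mxE eqxx (inj_eq enum_rank_inj). Qed.

Lemma vertex_image_inj : injective (fun u => f (vertex_pt R u)).
Proof.
have vr u : vertex_pt R u \in realization R G.
  rewrite in_setE; exists u, u; split; first by left.
  by apply/segmentP; exists 0; rewrite ?lexx ?ler01// subr0 scale1r scale0r addr0.
move=> u v /f_inj => /(_ (vr u) (vr v)) uv; apply/eqP.
have := vertex_coord v u; rewrite -uv vertex_coord eqxx.
by case: (u == v) => // /eqP; rewrite oner_eq0.
Qed.

Lemma edges_apart u v x y : sedge u v -> sedge x y -> uniq [:: u; v; x; y] ->
  \forall n \near \oo, forall i j, (i < n.+1)%N -> (j < n.+1)%N ->
    apart [:: sample n u v i; sample n u v i.+1]
          [:: sample n x y j; sample n x y j.+1].
Proof.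
move=> uv xy /and4P[]; rewrite !inE !negb_or => /and3P[uv' ux uy] /andP[vx vy] _ _.
(* An edge is treated as a homotopy that is constant in its first parameter. *)
pose Phi (w : R * R) := edge_path u v w.2.
have Phi_cont : continuous Phi.
  by move=> w; apply: continuous_comp; [exact: cvg_snd|exact: edge_path_continuous].
have disj s t t' : 0 <= s <= 1 -> 0 <= t <= 1 -> 0 <= t' <= 1 ->
    Phi (s, t) <> edge_path x y t'.
  move=> _ t01 t'01 /f_inj; rewrite !in_setE.
  move=> /(_ (realization_edge_pt _ uv) (realization_edge_pt _ xy)) /rowP e.
  have := e (enum_rank u); have := e (enum_rank v); rewrite !mxE /=.
  rewrite !(inj_eq enum_rank_inj) !eqxx (negPf ux) (negPf uy) (negPf vx) (negPf vy).
  rewrite [v == u]eq_sym (negPf uv') !mulr0 !mulr1 !addr0 add0r => ->.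
  by rewrite subr0 => /eqP; rewrite oner_eq0.
have := eventually_apart Phi_cont (edge_path_continuous xy) disj.
apply: filterS => n hn i j iN jN; apply: sub_apart (hn 0%N i j isT iN jN) => // p.
by rewrite !inE => /orP[]->; rewrite ?orbT.
Qed.

(** After [h], the first cycle shrinks along straight lines to a point of the lower half-space,
    which is convex, hence away from the second; [g] carries this contraction back. *)
Lemma split_cycle_linking c d : graph_cycle c -> graph_cycle d ->
  split_link (f @` cycle_realization R c) (f @` cycle_realization R d) ->
  \forall n \near \oo, cycle_linking n.+1 (sample n) c d = 0.
Proof.
move=> [/andP[cc uc] _] [/andP[cd ud] _] [h [[hc [g [gc hK gK]]] hA hB]].
pose q : 'rV[R]_3 := pt 0 0 (-1).
pose Phi u (w : R * R) :=
  g ((1 - clamp w.1) *: h (edge_path u (next c u) w.2) + clamp w.1 *: q).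
have sc u : u \in c -> sedge u (next c u) by exact: next_cycle.
have sd v : v \in d -> sedge v (next d v) by exact: next_cycle.
have below u t : u \in c -> zcoord (h (edge_path u (next c u) t)) < 0.
  move=> uin; apply: hA; exists (edge_path u (next c u) t) => //.
  by exists (edge_pt u (next c u) t) => //; exists u => //; exact: segment_edge_pt.
have above v t : v \in d -> 0 < zcoord (h (edge_path v (next d v) t)).
  move=> vin; apply: hB; exists (edge_path v (next d v) t) => //.
  by exists (edge_pt v (next d v) t) => //; exists v => //; exact: segment_edge_pt.
have Phi_cont u : u \in c -> continuous (Phi u).
  move=> uin; have c1 : continuous (fun w : R * R => clamp w.1).
    by move=> w; apply: continuous_comp; [exact: cvg_fst|exact: clamp_continuous].
  have c2 : continuous (fun w : R * R => edge_path u (next c u) w.2).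
    move=> w; apply: continuous_comp; first exact: cvg_snd.
    by apply: edge_path_continuous; exact: sc.
  have c3 : continuous (fun w : R * R => h (edge_path u (next c u) w.2)).
    by move=> w; exact: (continuous_comp (c2 w) (hc _)).
  have c4 : continuous (fun w : R * R =>
      (1 - clamp w.1) *: h (edge_path u (next c u) w.2) + clamp w.1 *: q).
    apply: cont_add; apply: cont_scale => //; try exact: cst_continuous.
    by apply: cont_add; [exact: cst_continuous|exact: cont_opp].
  by move=> w; exact: (continuous_comp (c4 w) (gc _)).
have disj u v : u \in c -> v \in d -> forall s t t', 0 <= s <= 1 -> 0 <= t <= 1 ->
    0 <= t' <= 1 -> Phi u (s, t) <> edge_path v (next d v) t'.
  move=> uin vin s t t' _ _ _ /(congr1 h); rewrite /Phi /= gK.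
  move=> /(congr1 (@zcoord R)) e.
  have := above v t' vin; rewrite -e ltNge => /negP; apply.
  have /andP[s0 s1] := clamp01 s; have b := below u t uin.
  have zE (a1 a2 : R) (p1 p2 : 'rV[R]_3) :
      zcoord (a1 *: p1 + a2 *: p2) = a1 * zcoord p1 + a2 * zcoord p2.
    by rewrite /zcoord !mxE.
  rewrite zE zcoord_pt.
  by have := mulr_ge0_le0 (x := 1 - clamp s) _ (ltW b); lra.
pose F n u k i := Phi u (k%:R / n.+1%:R, i%:R / n.+1%:R).
(* The track of a vertex is the same for the two edges of the cycle that meet there, so adjacent
   strips fit together. *)
pose H n k w := g ((1 - clamp (k%:R / n.+1%:R)) *: h (f (vertex_pt R w))
  + clamp (k%:R / n.+1%:R) *: q).
have : \forall n \near \oo, {in [seq (u, v) | u <- c, v <- d], forall uv : G * G,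
    forall k i j, (k < n.+1)%N -> (i < n.+1)%N -> (j < n.+1)%N ->
    apart [:: F n uv.1 k i; F n uv.1 k i.+1; F n uv.1 k.+1 i.+1; F n uv.1 k.+1 i]
          [:: sample n uv.2 (next d uv.2) j; sample n uv.2 (next d uv.2) j.+1]}.
  apply: eventually_all => _ /allpairsP[[u v] /= [uin vin ->]] /=.
  exact: eventually_apart (Phi_cont _ uin) (edge_path_continuous (sd _ vin))
    (disj _ _ uin vin).
apply: filterS => n hn.
apply: (@contractible_cycle_linking R n.+1 G (fun u => f (vertex_pt R u))
  (sample n) _ _ c d (F n) (H n) (g q)) => //.
- by move=> u v; exact: sample0.
- by move=> u v; exact: sample_last.
- move=> u i uin iN; rewrite /F /Phi /= mul0r clamp_id ?lexx ?ler01//.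
  by rewrite subr0 scale1r scale0r addr0 hK.
- move=> u i uin iN; rewrite /F /Phi /= divff ?pnatr_eq0// clamp_id ?lexx ?ler01//.
  by rewrite subrr scale0r scale1r add0r.
- by move=> u k uin kN; rewrite /F /Phi /= -/(sample n u _ 0) sample0.
- by move=> u k uin kN; rewrite /F /Phi /= -/(sample n u _ n.+1) sample_last.
- move=> u v k i j uin vin kN iN jN.
  by apply: (hn (u, v)) => //; apply/allpairsP; exists (u, v).
Qed.

End EdgePaths.

Definition labelled_cycle k (c : seq nat) : bool :=
  [&& uniq c, all (gtn 7%N) c, (2 < size c)%N &
      all (fun p => ordered p \in nth [::] linked_graphs k) (cyclic_pairs c)].

Lemma certificates_wf k cd : (k < 4)%N -> cd \in nth [::] certificates k ->
  [&& labelled_cycle k cd.1, labelled_cycle k cd.2 & ~~ has (mem cd.1) cd.2].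
Proof.
move=> k4; have : all (fun k => all (fun cd =>
  [&& labelled_cycle k cd.1, labelled_cycle k cd.2 & ~~ has (mem cd.1) cd.2])
  (nth [::] certificates k)) (iota 0 4) by [].
by move=> /allP/(_ k); rewrite mem_iota => /(_ k4)/allP; apply.
Qed.

Lemma cycle_cyclic_pairs (T : eqType) (e : rel T) (c : seq T) :
  cycle e c = all (fun p => e p.1 p.2) (cyclic_pairs c).
Proof.
case: c => [|x c] //; rewrite /cyclic_pairs rot1_cons /=.
have pathE a b s : path e a (rcons s b) =
    all (fun p => e p.1 p.2) (zip (a :: s) (rcons s b)).
  by elim: s a => //= y s IH a; rewrite IH.
exact: pathE.
Qed.

Lemma cyclic_pairs_map (S T : Type) (f : S -> T) (c : seq S) :
  cyclic_pairs (map f c) = [seq (f p.1, f p.2) | p <- cyclic_pairs c].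
Proof.
rewrite /cyclic_pairs -map_rot; elim: c (rot 1 c) => [|x c IH] [|y s] //=.
by rewrite IH.
Qed.

Section LinkedSubgraph.
Variables (R : realType) (G : sgraph) (k : nat) (t : seq G) (x0 : G).
Hypothesis k4 : (k < 4)%N.
Hypothesis t_uniq : uniq t.
Hypothesis t_size : size t = 7%N.
Hypothesis t_edge : {in nth [::] linked_graphs k,
  forall p, sedge (nth x0 t p.1) (nth x0 t p.2)}.

Let vtx i := nth x0 t i.

Let vtx_eq i j : (i < 7)%N -> (j < 7)%N -> (vtx i == vtx j) = (i == j).
Proof. by move=> i7 j7; rewrite nth_uniq ?t_size. Qed.

Let uniq_vtx c : uniq c -> all (gtn 7%N) c -> uniq (map vtx c).
Proof.
move=> uc /allP c7; rewrite map_inj_in_uniq// => i j /c7 i7 /c7 j7 /eqP.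
by rewrite vtx_eq// => /eqP.
Qed.

Let next_vtx c i : uniq c -> all (gtn 7%N) c -> i \in c ->
  next (map vtx c) (vtx i) = vtx (next c i).
Proof.
move=> uc c7 ic; have : (vtx i, vtx (next c i)) \in cyclic_pairs (map vtx c).
  rewrite cyclic_pairs_map; apply/mapP; exists (i, next c i) => //.
  by rewrite mem_cyclic_pairs// ic eqxx.
by rewrite mem_cyclic_pairs ?uniq_vtx// => /andP[_ /eqP].
Qed.

Let labelled_graph_cycle c : labelled_cycle k c -> graph_cycle (map vtx c).
Proof.
move=> /and4P[uc c7 c3 /allP ce]; split; last by rewrite size_map.
apply/andP; split; last exact: uniq_vtx.
rewrite cycle_cyclic_pairs cyclic_pairs_map all_map.
apply/allP => -[i j] /ce; rewrite /ordered /= => /t_edge.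
by case: ifP => //= _; rewrite sedge_sym.
Qed.

Lemma linked_subgraph_intrinsically_linked : intrinsically_linked R G.
Proof.
move=> f [f_cont f_inj _]; apply: contrapT => unlinked.
have split c d : graph_cycle c -> graph_cycle d -> ~~ has (mem c) d ->
    split_link (f @` cycle_realization R c) (f @` cycle_realization R d).
  move=> gc gd cd; apply: contrapT => ns; apply: unlinked; exists c, d.
  split=> // u uc; apply/negP => ud; move/hasPn: cd => /(_ u ud).
  by rewrite /= uc.
have ev_unlinked : \forall n \near \oo, {in nth [::] certificates k, forall cd,
    cycle_linking n.+1 (sample f n) (map vtx cd.1) (map vtx cd.2) = 0}.
  apply: eventually_all => cd /(certificates_wf k4)/and3P[lc ld cd0].
  apply: split_cycle_linking => //; [exact: labelled_graph_cycle..|].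
  apply: split; [exact: labelled_graph_cycle..|].
  apply/hasPn => _ /mapP[j jd ->] /=; apply/mapP => -[i ic] /eqP.
  move: lc ld => /and4P[_ /allP c7 _ _] /and4P[_ /allP d7 _ _].
  rewrite (vtx_eq (d7 _ jd) (c7 _ ic)) => /eqP ji; move/hasPn: cd0 => /(_ j jd).
  by rewrite /= ji ic.
pose E := nth [::] linked_graphs k.
have E7 e : e \in E -> (e.1 < 7)%N && (e.2 < 7)%N.
  have : all (fun e => (e.1 < 7)%N && (e.2 < 7)%N) (flatten linked_graphs) by [].
  by move=> /allP h eE; apply: h; apply/flattenP; exists E => //; rewrite mem_nth.
have ev_apart : \forall n \near \oo, {in [seq (e, e') | e <- E, e' <- E],
    forall p : (nat * nat) * (nat * nat),
    uniq [:: p.1.1; p.1.2; p.2.1; p.2.2] ->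
    forall i j, (i < n.+1)%N -> (j < n.+1)%N ->
    apart [:: sample f n (vtx p.1.1) (vtx p.1.2) i;
              sample f n (vtx p.1.1) (vtx p.1.2) i.+1]
          [:: sample f n (vtx p.2.1) (vtx p.2.2) j;
              sample f n (vtx p.2.1) (vtx p.2.2) j.+1]}.
  apply: eventually_all => _ /allpairsP[[e e'] /= [eE e'E ->]] /=.
  have [u|nu] := boolP (uniq [:: e.1; e.2; e'.1; e'.2]); last first.
    by apply: nearW => n u; case/negP: nu.
  have /andP[e1 e2] := E7 _ eE; have /andP[e1' e2'] := E7 _ e'E.
  have := edges_apart f_cont f_inj (t_edge eE) (t_edge e'E).
  rewrite -/(vtx _) => /(_ (uniq_vtx u _)); rewrite /= e1 e2 e1' e2' => /(_ isT).
  by apply: filterS => n h _.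
have [n [n_unlinked n_apart]] := filter_ex (filterI ev_unlinked ev_apart).
pose p i := f (vertex_pt R (vtx i)).
apply: (@certificate_sound k
  (fun a b c d =>
     path_over n.+1 (sample f n (vtx a) (vtx b)) (sample f n (vtx c) (vtx d)))
  (fun a b c => path_under n.+1 (sample f n (vtx a) (vtx b)) (p c))
  (fun a b => before (p a) (p b)) k4).
- by move=> a b c d; apply: path_over_rev => i iN; rewrite -sample_rev.
- by move=> a b c d; apply: path_over_revr => i iN; rewrite -sample_rev.
- move=> e e' eE e'E u; rewrite path_over_cross; last first.
    apply: (n_apart (e, e')) => //; apply/allpairsP; by exists (e, e').
  by rewrite !sample0 !sample_last.
- move=> u v /andP[uv v7]; have u7 := ltn_trans uv v7.
  apply: before_total; apply: contraT; rewrite !negb_or !negbK.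
  move=> /and3P[/eqP ex /eqP ey /eqP ez].
  have /eqP := vertex_image_inj f_inj (pt_eq ex ey ez).
  by rewrite vtx_eq// => /eqP uvE; rewrite uvE ltnn in uv.
- move=> cd cdin; have /and3P[lc ld _] := certificates_wf k4 cdin.
  move: lc ld => /and4P[uc c7 _ _] /and4P[ud d7 _ _].
  rewrite -[RHS](n_unlinked cd cdin) /cycle_linking big_map.
  apply: eq_big_seq => i ic; rewrite big_map; apply: eq_big_seq => j jd.
  by rewrite !next_vtx.
Qed.

End LinkedSubgraph.

End Intrinsic.

(** * The theorem *)

Lemma obstructed_not_knotted (R : realType) (G : sgraph) (lab : nat -> G) :
  #|G| = 8 -> {in gtn 7 &, injective lab} ->
  obstructed (fun i j => sedge (lab i) (lab j)) -> ~ intrinsically_knotted R G.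
Proof.
move=> G8 lab_inj [miss missin [t [ut /allP t7 /allP tsz tmiss]]].
(* The vertices of the pattern come first, so that their positions are the labels used in [miss];
   the others fill up the configuration. *)
pose u := map lab t; pose s := u ++ [seq x <- enum G | x \notin u].
have uu : uniq u by rewrite map_inj_in_uniq// => i j /t7 i7 /t7 j7; exact: lab_inj.
have us : uniq s.
  rewrite cat_uniq uu filter_uniq ?enum_uniq// andbT /=.
  by apply/hasPn => x; rewrite mem_filter => /andP[].
have sall x : x \in s by rewrite mem_cat mem_filter mem_enum andbT orbN.
have s8 : size s = 8.
  rewrite -G8 cardE; apply: perm_size; apply: uniq_perm us (enum_uniq _) _ => x.
  by rewrite sall mem_enum.
have smiss : {in miss, forall p, ~~ sedge (nth (lab 0) s p.1) (nth (lab 0) s p.2)}.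
  move=> p pin; have /andP[p1 p2] := tsz p pin; have := tmiss p pin.
  by rewrite !nth_cat !size_map p1 p2 !(nth_map 0).
move: missin; rewrite !inE => /orP[]/eqP missE; rewrite missE in smiss.
  exact: (@straight_not_knotted R G conf1 miss1 s (lab 0) s8 sall smiss
    config1_ok general_position1).
exact: (@straight_not_knotted R G conf2 miss2 s (lab 0) s8 sall smiss
    config2_ok general_position2).
Qed.

Theorem theorem9 (R : realType) (G : sgraph) (v : G) :
  #|G| = 8 -> intrinsically_knotted R G ->
  intrinsically_linked R (del_vertex v).
Proof.
move=> G8 knotted; pose H := del_vertex v.
have H7 : #|H| = 7 by rewrite card_sig -[7]/(8.-1) -G8 -(cardC1 v); exact: eq_card.
have [y0 _] : exists y0 : H, true.
  have /card_gt0P[y0 _] : 0 < #|H| by rewrite H7.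
  by exists y0.
pose lab i := nth y0 (enum H) i.
have lab_inj : {in gtn 7 &, injective lab}.
  move=> i j i7 j7 /eqP; rewrite nth_uniq -?cardE ?H7 ?enum_uniq//.
  by move=> /eqP.
have [obs|[k [t [k4 tperm tE]]]] :=
    classification (fun i j => sedge_sym (lab i) (lab j)).
  (* Adjacency in [del_vertex v] is that of [G], so a pattern of nonedges found there is one in
     [G]. *)
  case: (@obstructed_not_knotted R G (fun i => val (lab i)) G8 _ obs knotted).
  by move=> i j i7 j7 /val_inj; exact: lab_inj.
have ut : uniq t by rewrite (perm_uniq tperm) iota_uniq.
have t7 i : i \in t -> i < 7 by rewrite (perm_mem tperm) mem_iota.
have sz : size t = 7 by rewrite (perm_size tperm) size_iota.
apply: (@linked_subgraph_intrinsically_linked R H k (map lab t) y0 k4).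
- by rewrite map_inj_in_uniq// => i j /t7 i7 /t7 j7; exact: lab_inj.
- by rewrite size_map.
- move=> p pE; have := tE p pE.
  have : all (fun e => (e.1 < 7) && (e.2 < 7)) (flatten linked_graphs) by [].
  move=> /allP/(_ p) => /(_ _)/andP[|p1 p2].
    by apply/flattenP; exists (nth [::] linked_graphs k) => //; rewrite mem_nth.
  by rewrite !(nth_map 0) ?sz.
Qed.
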